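(* Let $\mathbb{K}$ be an algebraically closed field of characteristic $0$, let $\mathfrak{l}$ be a semisimple Lie superalgebra over $\mathbb{K}$, and let $\mathfrak{g}=\mathfrak{l}\otimes\mathbb{K}[x]$ or $\mathfrak{g}=\mathfrak{l}\otimes\mathbb{K}[x,x^{-1}]$ be its current superalgebra or loop superalgebra. Then the center of the universal enveloping superalgebra $U(\mathfrak{g})$ is $Z(\mathfrak{g})=\mathbb{K}$.
   Context: The current superalgebra $\mathfrak{l}\otimes\mathbb{K}[x]$ and the loop superalgebra $\mathfrak{l}\otimes\mathbb{K}[x,x^{-1}]$ have $\mathbb{Z}_2$-grading $|e\otimes x^r|=|e|$ and bracket $[e\otimes x^r,f\otimes x^s]=[e,f]\otimes x^{r+s}$ for $e,f\in\mathfrak{l}$ and $r,s\in\mathbb{N}$ (resp. $r,s\in\mathbb{Z}$). $Z(\mathfrak{g})=\{z\in U(\mathfrak{g})\mid [z,u]=0\ \forall u\in U(\mathfrak{g})\}$, where $[z,u]=zu-(-1)^{|z||u|}uz$ for homogeneous $z,u$, extended bilinearly. A Lie superalgebra is semisimple if it has no nonzero solvable (graded) ideals. *)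

(* Defs.v *)
From HB Require Import structures.
From mathcomp Require Import all_boot all_order all_algebra.
From mathcomp Require Import generic_quotient ring_quotient.
From mathcomp Require Import boolp classical_sets.
From mathcomp Require Import finmap monalg.

Set Implicit Arguments.
Unset Strict Implicit.
Unset Printing Implicit Defensive.

Import GRing.Theory.

Local Open Scope ring_scope.
Local Open Scope classical_set_scope.
Local Open Scope quotient_scope.

(* The axioms below are the usual ones for super vector spaces, Lie
   superalgebras and associative superalgebras over a field in which 2 and 3
   are invertible. Parities live in Z/2, encoded as [bool] with [(+)] as
   addition and [&&] as multiplication, and [spart a v] is the homogeneous
   component of [v] of parity [a]. *)
HB.mixin Record Lmodule_isSuper (K : fieldType) V of GRing.Lmodule K V := {
  spart : bool -> V -> V;
  spart_linear : forall a, linear (spart a);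
  spartK : forall a b v, spart a (spart b v) = if a == b then spart b v else 0;
  spart_sum : forall v, spart false v + spart true v = v
}.

#[short(type="superLmodType")]
HB.structure Definition SuperLmodule (K : fieldType) :=
  {V of GRing.Lmodule K V & Lmodule_isSuper K V}.

Definition homog (K : fieldType) (V : superLmodType K) (a : bool) (v : V) :=
  spart a v = v.

HB.mixin Record SuperLmodule_isLieSuper (K : fieldType) V
    of SuperLmodule K V := {
  sbracket : V -> V -> V;
  sbracket_linear_l : forall v, linear (sbracket^~ v);
  sbracket_linear_r : forall u, linear (sbracket u);
  sbracket_homog : forall a b (u v : V), homog a u -> homog b v ->
    homog (a (+) b) (sbracket u v);
  sbracket_skew : forall a b (u v : V), homog a u -> homog b v ->
    sbracket u v = - ((-1) ^+ (a && b) *: sbracket v u);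
  sbracket_jacobi : forall a b (u v w : V), homog a u -> homog b v ->
    sbracket u (sbracket v w) =
      sbracket (sbracket u v) w + (-1) ^+ (a && b) *: sbracket v (sbracket u w)
}.

#[short(type="lieSuperType")]
HB.structure Definition LieSuper (K : fieldType) :=
  {V of SuperLmodule K V & SuperLmodule_isLieSuper K V}.

HB.mixin Record isSuperAlgebra (K : fieldType) A
    of GRing.Algebra K A & SuperLmodule K A := {
  homog1 : homog false (1 : A);
  homogM : forall a b (x y : A), homog a x -> homog b y ->
    homog (a (+) b) (x * y)
}.

#[short(type="superAlgType")]
HB.structure Definition SuperAlgebra (K : fieldType) :=
  {A of GRing.Algebra K A & SuperLmodule K A & isSuperAlgebra K A}.

Section SuperTheory.
Context (K : fieldType) (V : superLmodType K).
Implicit Types (a b : bool) (u v : V).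

HB.instance Definition _ a :=
  GRing.isLinear.Build K V V *:%R (spart a) (@spart_linear K V a).

Lemma spart0 a : spart a (0 : V) = 0.
Proof. exact: linear0. Qed.

Lemma spartD a u v : spart a (u + v) = spart a u + spart a v.
Proof. exact: linearD. Qed.

Lemma spartZ a (c : K) v : spart a (c *: v) = c *: spart a v.
Proof. exact: linearZ. Qed.

Lemma spart_homog a v : homog a (spart a v).
Proof. by rewrite /homog spartK eqxx. Qed.

Lemma homog_spart a b v : homog a v -> spart b v = if b == a then v else 0.
Proof. by move=> hv; rewrite -{1}hv spartK hv. Qed.

Lemma spart_sumb v : \sum_(a : bool) spart a v = v.
Proof. by rewrite big_bool /= addrC spart_sum. Qed.

End SuperTheory.

Section Semisimple.
Context (K : fieldType) (l : lieSuperType K).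

Definition graded_ideal (I : set l) : Prop :=
  [/\ I 0,
      forall (c : K) u v, I u -> I v -> I (c *: u + v),
      forall a v, I v -> I (spart a v),
      forall u v, I v -> I (sbracket u v)
    & forall u v, I v -> I (sbracket v u)].

Inductive derived (I : set l) : l -> Prop :=
| derived0 : derived I 0
| derived_add u v : derived I u -> derived I v -> derived I (u + v)
| derived_bracket (c : K) u v : I u -> I v -> derived I (c *: sbracket u v).

Definition solvable (I : set l) : Prop :=
  exists n, iter n derived I `<=` [set 0].

Definition semisimple : Prop :=
  forall I : set l, graded_ideal I -> solvable I -> I `<=` [set 0].

End Semisimple.

Section SuperCenter.
Context (K : fieldType) (A : superAlgType K).

Definition supercomm (x y : A) : A :=
  \sum_(a : bool) \sum_(b : bool)
    (spart a x * spart b y - (-1) ^+ (a && b) *: (spart b y * spart a x)).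

Lemma supercomm_homog a b x y : homog a x -> homog b y ->
  supercomm x y = x * y - (-1) ^+ (a && b) *: (y * x).
Proof.
move=> hx hy; rewrite /supercomm (bigD1 a) //= [X in _ + X]big1 ?addr0.
  rewrite (bigD1 b) //= [X in _ + X]big1 ?addr0 ?hx ?hy // => b' nb.
  by rewrite (homog_spart b' hy) (negbTE nb) !(mulr0, mul0r) scaler0 subr0.
move=> a' na; apply: big1 => b' _.
by rewrite (homog_spart a' hx) (negbTE na) !(mulr0, mul0r) scaler0 subr0.
Qed.

Definition supercenter : set A := [set z | forall u, supercomm z u = 0].

End SuperCenter.

Arguments supercenter {K} A _.

(* For a commutative monoid [M], written additively, [l] tensored with the
   monoid algebra of [M], as the direct sum of copies of [l] indexed by [M]:
   finitely supported functions from [M] to [l]. The pure tensor of [e] with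
   the basis element of index [r] is [<< e *g r >>]. *)
Definition monoid_tensor (K : fieldType) (M : nmodType) (l : lieSuperType K) :
  Type := {malg l[M]}.

Section MonoidTensor.
Context (K : fieldType) (M : nmodType) (l : lieSuperType K).
Local Notation g := (monoid_tensor M l).

HB.instance Definition _ := GRing.Zmodule.on g.

Lemma monoid_tensor_ind (P : g -> Prop) :
  P 0 -> (forall x y, P x -> P y -> P (x + y)) ->
  (forall e r, P << e *g r >>) -> forall x, P x.
Proof. by move=> P0 PD PU x; rewrite [x]monalgE; elim/big_ind: _. Qed.

Let ext (W : zmodType) (f : l -> M -> W) (x : g) : W :=
  \sum_(r <- msupp x) f x@_r r.

Section Ext.
Context (W : zmodType) (f : l -> M -> W).
Hypothesis f_add : forall r, {morph f^~ r : e e' / e + e'}.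

Let f0 r : f 0 r = 0.
Proof. by apply: (addIr (f 0 r)); rewrite -f_add !add0r. Qed.

Let extw (d : {fset M}) (x : g) :
  (msupp x `<=` d)%fset -> ext f x = \sum_(r <- d) f x@_r r.
Proof.
move=> le; rewrite /ext (big_fset_incl _ le) //= => r _ /mcoeff_outdom ->.
exact: f0.
Qed.

Let extU e r : ext f << e *g r >> = f e r.
Proof. by rewrite (extw msuppU_le) big_seq_fset1 mcoeffUU. Qed.

Let extD x y : ext f (x + y) = ext f x + ext f y.
Proof.
pose d := (msupp x `|` msupp y)%fset.
rewrite (extw (fsubsetUl (msupp x) (msupp y) : (_ `<=` d)%fset)).
rewrite (extw (fsubsetUr (msupp x) (msupp y) : (_ `<=` d)%fset)).
rewrite (extw (msuppD_le _ _ : (_ `<=` d)%fset)) -big_split /=.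
by apply: eq_bigr => r _; rewrite mcoeffD f_add.
Qed.

Let ext0 : ext f 0 = 0.
Proof. by rewrite /ext msupp0 big_seq_fset0. Qed.

Lemma monoid_tensor_ext :
  [/\ ext f 0 = 0, {morph ext f : x y / x + y}
    & forall e r, ext f << e *g r >> = f e r].
Proof. by []. Qed.

End Ext.

Definition mt_scale (c : K) (x : g) : g :=
  \sum_(r <- msupp x) << c *: x@_r *g r >>.

Lemma mt_scaleP c : [/\ mt_scale c 0 = 0, {morph mt_scale c : x y / x + y}
  & forall e r, mt_scale c << e *g r >> = << c *: e *g r >>].
Proof.
by apply: (@monoid_tensor_ext _ (fun e r => << c *: e *g r >> : g)) => r e e';
  rewrite scalerDr monalgUD.
Qed.

Lemma mt_scaleA c d x : mt_scale c (mt_scale d x) = mt_scale (c * d) x.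
Proof.
have [c0 cD cU] := mt_scaleP c; have [d0 dD dU] := mt_scaleP d.
have [e0 eD eU] := mt_scaleP (c * d).
elim/monoid_tensor_ind: x => [|x y hx hy|e r]; first by rewrite d0 c0 e0.
  by rewrite dD cD hx hy eD.
by rewrite dU cU eU scalerA.
Qed.

Lemma mt_scale1 x : mt_scale 1 x = x.
Proof.
have [c0 cD cU] := mt_scaleP 1.
elim/monoid_tensor_ind: x => [//|x y hx hy|e r]; first by rewrite cD hx hy.
by rewrite cU scale1r.
Qed.

Lemma mt_scaleDr c x y : mt_scale c (x + y) = mt_scale c x + mt_scale c y.
Proof. by have [_ cD _] := mt_scaleP c; rewrite cD. Qed.

Lemma mt_scaleDl x c d : mt_scale (c + d) x = mt_scale c x + mt_scale d x.
Proof.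
have [c0 cD cU] := mt_scaleP c; have [d0 dD dU] := mt_scaleP d.
have [e0 eD eU] := mt_scaleP (c + d).
elim/monoid_tensor_ind: x => [|x y hx hy|e r].
- by rewrite c0 d0 e0 addr0.
- by rewrite cD dD eD hx hy addrACA.
- by rewrite cU dU eU scalerDl monalgUD.
Qed.

HB.instance Definition _ := GRing.Zmodule_isLmodule.Build K g
  mt_scaleA mt_scale1 mt_scaleDr mt_scaleDl.

Lemma monoid_tensorZ (c : K) e r :
  c *: (<< e *g r >> : g) = << c *: e *g r >>.
Proof. by have [_ _] := mt_scaleP c; apply. Qed.

Definition mt_part (a : bool) (x : g) : g :=
  \sum_(r <- msupp x) << spart a x@_r *g r >>.

Lemma mt_partP a : [/\ mt_part a 0 = 0, {morph mt_part a : x y / x + y}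
  & forall e r, mt_part a << e *g r >> = << spart a e *g r >>].
Proof.
by apply: (@monoid_tensor_ext _ (fun e r => << spart a e *g r >> : g));
  move=> r e e'; rewrite linearD monalgUD.
Qed.

Lemma mt_part_linear a : linear (mt_part a).
Proof.
have [a0 aD aU] := mt_partP a.
move=> c x y; rewrite aD.
suff -> : mt_part a (c *: x) = c *: mt_part a x by [].
elim/monoid_tensor_ind: x => [|x z hx hz|e r].
- by rewrite scaler0 a0 scaler0.
- by rewrite scalerDr !aD hx hz scalerDr.
- by rewrite monoid_tensorZ !aU monoid_tensorZ linearZ.
Qed.

Lemma mt_partK a b x :
  mt_part a (mt_part b x) = if a == b then mt_part b x else 0.
Proof.
have [a0 aD aU] := mt_partP a; have [b0 bD bU] := mt_partP b.
elim/monoid_tensor_ind: x => [|x z hx hz|e r].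
- by rewrite b0 a0 if_same.
- by rewrite bD aD hx hz; case: ifP => // _; rewrite addr0.
- by rewrite bU aU spartK; case: ifP => // _; rewrite monalgU0.
Qed.

Lemma mt_part_sum x : mt_part false x + mt_part true x = x.
Proof.
have [a0 aD aU] := mt_partP false; have [b0 bD bU] := mt_partP true.
elim/monoid_tensor_ind: x => [|x z hx hz|e r].
- by rewrite b0 a0 addr0.
- by rewrite bD aD addrACA hx hz.
- by rewrite aU bU -monalgUD spart_sum.
Qed.

HB.instance Definition _ := Lmodule_isSuper.Build K g
  mt_part_linear mt_partK mt_part_sum.

Lemma monoid_tensor_part a e r :
  spart a (<< e *g r >> : g) = << spart a e *g r >>.
Proof. by have [_ _] := mt_partP a; apply. Qed.

Definition mt_bracket (x y : g) : g :=
  \sum_(r <- msupp x) \sum_(s <- msupp y)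
    << sbracket x@_r y@_s *g (r + s)%R >>.

Let sbrDl (v : l) : {morph sbracket^~ v : e e' / e + e'}.
Proof.
by move=> e e'; have := sbracket_linear_l v 1 e e'; rewrite /= !scale1r.
Qed.

Let sbrDr (v : l) : {morph sbracket v : e e' / e + e'}.
Proof.
by move=> e e'; have := sbracket_linear_r v 1 e e'; rewrite /= !scale1r.
Qed.

Let sbr0l (v : l) : sbracket 0 v = 0.
Proof. by apply: (addIr (sbracket 0 v)); rewrite -sbrDl !add0r. Qed.

Let sbr0r (v : l) : sbracket v 0 = 0.
Proof. by apply: (addIr (sbracket v 0)); rewrite -sbrDr !add0r. Qed.

Let sbrZl (c : K) (u v : l) : sbracket (c *: u) v = c *: sbracket u v.
Proof.
by have := sbracket_linear_l v c u 0; rewrite /= addr0 sbr0l addr0.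
Qed.

Let sbrZr (c : K) (u v : l) : sbracket u (c *: v) = c *: sbracket u v.
Proof.
by have := sbracket_linear_r u c v 0; rewrite /= addr0 sbr0r addr0.
Qed.

Let inner e r (y : g) : g :=
  \sum_(s <- msupp y) << sbracket e y@_s *g (r + s)%R >>.

Let innerP e r : [/\ inner e r 0 = 0, {morph inner e r : x y / x + y}
  & forall f s, inner e r << f *g s >> = << sbracket e f *g (r + s)%R >>].
Proof.
apply: (@monoid_tensor_ext _ (fun f s => << sbracket e f *g (r + s)%R >> : g)).
by move=> s f f'; rewrite sbrDr monalgUD.
Qed.

Let mt_bracketP (y : g) :
  [/\ mt_bracket 0 y = 0, {morph mt_bracket^~ y : x x' / x + x'}
  & forall e r, mt_bracket << e *g r >> y = inner e r y].
Proof.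
apply: (@monoid_tensor_ext _ (fun e r => inner e r y)) => r e e'.
by rewrite /inner -big_split; apply: eq_bigr => s _; rewrite sbrDl monalgUD.
Qed.

Let brDl (y : g) : {morph mt_bracket^~ y : x x' / x + x'}.
Proof. by have [] := mt_bracketP y. Qed.
Let br0l (y : g) : mt_bracket 0 y = 0.
Proof. by have [] := mt_bracketP y. Qed.

Let brUU e r f s :
  mt_bracket << e *g r >> << f *g s >> = << sbracket e f *g (r + s)%R >>.
Proof.
have [_ _ ->] := mt_bracketP << f *g s >>.
by have [_ _ ->] := innerP e r.
Qed.

Let br0r (x : g) : mt_bracket x 0 = 0.
Proof.
elim/monoid_tensor_ind: x => [//|x y hx hy|e r]; first by rewrite brDl hx hy addr0.
have [_ _ ->] := mt_bracketP 0.
by have [-> _ _] := innerP e r.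
Qed.

Let brDr (x : g) : {morph mt_bracket x : y y' / y + y'}.
Proof.
move=> y y'; elim/monoid_tensor_ind: x => [|x z hx hz|e r].
- by rewrite !br0l addr0.
- by rewrite !brDl hx hz addrACA.
- have [_ _ ->] := mt_bracketP (y + y').
  have [_ _ ->] := mt_bracketP y; have [_ _ ->] := mt_bracketP y'.
  by have [_ -> _] := innerP e r.
Qed.

Let brZl (c : K) (x y : g) : mt_bracket (c *: x) y = c *: mt_bracket x y.
Proof.
elim/monoid_tensor_ind: x => [|x z hx hz|e r].
- by rewrite scaler0 br0l scaler0.
- by rewrite scalerDr !brDl hx hz scalerDr.
elim/monoid_tensor_ind: y => [|x z hx hz|f s].
- by rewrite !br0r scaler0.
- by rewrite !brDr hx hz scalerDr.
- by rewrite monoid_tensorZ !brUU monoid_tensorZ sbrZl.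
Qed.

Let brZr (c : K) (x y : g) : mt_bracket x (c *: y) = c *: mt_bracket x y.
Proof.
elim/monoid_tensor_ind: x => [|x z hx hz|e r].
- by rewrite !br0l scaler0.
- by rewrite !brDl hx hz scalerDr.
elim/monoid_tensor_ind: y => [|x z hx hz|f s].
- by rewrite scaler0 br0r scaler0.
- by rewrite scalerDr !brDr hx hz scalerDr.
- by rewrite monoid_tensorZ !brUU monoid_tensorZ sbrZr.
Qed.

Lemma mt_bracket_linear_l y : linear (mt_bracket^~ y).
Proof. by move=> c x x'; rewrite brDl brZl. Qed.

Lemma mt_bracket_linear_r x : linear (mt_bracket x).
Proof. by move=> c y y'; rewrite brDr brZr. Qed.

Let homog_ind a (P : g -> Prop) :
  P 0 -> (forall x y, P x -> P y -> P (x + y)) ->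
  (forall e r, homog a e -> P << e *g r >>) -> forall x, homog a x -> P x.
Proof.
move=> P0 PD PU x <-.
elim/monoid_tensor_ind: x => [|x y hx hy|e r]; first by rewrite linear0.
  by rewrite linearD; apply: PD.
by rewrite monoid_tensor_part; apply/PU/spart_homog.
Qed.

Lemma mt_bracket_homog a b (x y : g) : homog a x -> homog b y ->
  homog (a (+) b) (mt_bracket x y).
Proof.
rewrite /homog => hx hy; elim/homog_ind: hx => [|x1 x2 h1 h2|e r he].
- by rewrite br0l spart0.
- by rewrite brDl spartD h1 h2.
elim/homog_ind: hy => [|x1 x2 h1 h2|f s hf].
- by rewrite br0r spart0.
- by rewrite brDr spartD h1 h2.
by rewrite brUU monoid_tensor_part sbracket_homog.
Qed.

Lemma mt_bracket_skew a b (x y : g) : homog a x -> homog b y ->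
  mt_bracket x y = - ((-1) ^+ (a && b) *: mt_bracket y x).
Proof.
move=> hx hy; elim/homog_ind: hx => [|x1 x2 h1 h2|e r he].
- by rewrite br0l br0r scaler0 oppr0.
- by rewrite brDl brDr h1 h2 scalerDr opprD.
elim/homog_ind: hy => [|x1 x2 h1 h2|f s hf].
- by rewrite br0l br0r scaler0 oppr0.
- by rewrite brDl brDr h1 h2 scalerDr opprD.
by rewrite !brUU monoid_tensorZ -monalgUN (sbracket_skew _ _ _ _ he hf) addrC.
Qed.

Lemma mt_bracket_jacobi a b (x y z : g) : homog a x -> homog b y ->
  mt_bracket x (mt_bracket y z) =
    mt_bracket (mt_bracket x y) z
      + (-1) ^+ (a && b) *: mt_bracket y (mt_bracket x z).
Proof.
move=> hx hy; elim/homog_ind: hx => [|x1 x2 h1 h2|e r he].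
- by rewrite !(br0l, br0r) scaler0 addr0.
- by rewrite !(brDl, brDr) h1 h2 scalerDr addrACA.
elim/homog_ind: hy => [|x1 x2 h1 h2|f s hf].
- by rewrite !(br0l, br0r) scaler0 addr0.
- by rewrite !(brDl, brDr) h1 h2 scalerDr addrACA.
elim/monoid_tensor_ind: z => [|x1 x2 h1 h2|k t].
- by rewrite !(br0l, br0r) scaler0 addr0.
- by rewrite !(brDl, brDr) h1 h2 scalerDr addrACA.
rewrite !brUU monoid_tensorZ (sbracket_jacobi _ _ _ _ _ he hf) monalgUD.
by rewrite (addrCA s r t) !addrA.
Qed.

HB.instance Definition _ := SuperLmodule_isLieSuper.Build K g
  mt_bracket_linear_l mt_bracket_linear_r
  mt_bracket_homog mt_bracket_skew mt_bracket_jacobi.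

Lemma monoid_tensor_bracket e f r s :
  sbracket (<< e *g r >> : g) << f *g s >> = << sbracket e f *g (r + s)%R >>.
Proof. exact: brUU. Qed.

End MonoidTensor.

Definition current_superalgebra (K : fieldType) (l : lieSuperType K) :
  lieSuperType K := monoid_tensor nat l.

Definition loop_superalgebra (K : fieldType) (l : lieSuperType K) :
  lieSuperType K := monoid_tensor int l.

HB.mixin Record isTwoSidedIdeal (R : nzRingType) (S : R -> bool) := {
  ideal1_subproof : 1 \notin S;
  idealM_subproof : forall x y z, y \in S -> x * y * z \in S
}.

#[short(type="twoSidedIdeal")]
HB.structure Definition TwoSidedIdeal (R : nzRingType) :=
  {S of GRing.ZmodClosed R S & isTwoSidedIdeal R S}.

Definition alg_quot (K : fieldType) (A : algType K) (I : twoSidedIdeal A) :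
  Type := Quotient.quot I.

Section QuotientAlgebra.
Context (K : fieldType) (A : algType K) (I : twoSidedIdeal A).
Local Notation Q := (alg_quot I).
Implicit Types (x y z : A) (u v w : Q) (c d : K).

HB.instance Definition _ := GRing.Zmodule.on Q.

Definition quot_pi x : Q := \pi x.

Lemma quot_piP u : exists x, u = quot_pi x.
Proof. by exists (repr u); rewrite /quot_pi reprK. Qed.

Lemma quot_pi_eq x y : quot_pi x = quot_pi y <-> x - y \in I.
Proof.
by rewrite Quotient.idealrBE; split => [h|/eqP//]; apply/eqP.
Qed.

Let piD x y : quot_pi (x + y) = quot_pi x + quot_pi y.
Proof. exact: (@Quotient.pi_add A I x y). Qed.

Definition quot_one : Q := quot_pi 1.
Definition quot_mul u v : Q := quot_pi (repr u * repr v).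
Definition quot_scale c u : Q := quot_pi (c *: repr u).

Let reprE x : repr (quot_pi x) - x \in I.
Proof. by apply/quot_pi_eq; rewrite /quot_pi reprK. Qed.

Let idealMl x y : y \in I -> x * y \in I.
Proof. by move=> h; rewrite -[x * y]mulr1; apply: idealM_subproof. Qed.

Let idealMr x y : x \in I -> x * y \in I.
Proof. by move=> h; rewrite -[x]mul1r; apply: idealM_subproof. Qed.

Let piM x y : quot_pi (x * y) = quot_mul (quot_pi x) (quot_pi y).
Proof.
apply/esym/quot_pi_eq; set x' := repr _; set y' := repr _.
have -> : x' * y' - x * y = (x' - x) * y' + x * (y' - y).
  by rewrite mulrBl mulrBr addrA subrK.
by apply: rpredD; [apply: idealMr|apply: idealMl]; apply: reprE.
Qed.

Let piZ c x : quot_pi (c *: x) = quot_scale c (quot_pi x).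
Proof.
apply/esym/quot_pi_eq; rewrite -scalerBr -[_ - x]mul1r scalerAl.
exact/idealMl/reprE.
Qed.

Lemma quot_mulA : associative quot_mul.
Proof.
move=> u v w.
have [x ->] := quot_piP u; have [y ->] := quot_piP v.
by have [z ->] := quot_piP w; rewrite -!piM mulrA.
Qed.

Lemma quot_mul1 : left_id quot_one quot_mul.
Proof. by move=> u; have [x ->] := quot_piP u; rewrite -piM mul1r. Qed.

Lemma quot_mulr1 : right_id quot_one quot_mul.
Proof. by move=> u; have [x ->] := quot_piP u; rewrite -piM mulr1. Qed.

Lemma quot_mulDl : left_distributive quot_mul +%R.
Proof.
move=> u v w.
have [x ->] := quot_piP u; have [y ->] := quot_piP v.
by have [z ->] := quot_piP w; rewrite -piD -!piM mulrDl piD.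
Qed.

Lemma quot_mulDr : right_distributive quot_mul +%R.
Proof.
move=> u v w.
have [x ->] := quot_piP u; have [y ->] := quot_piP v.
by have [z ->] := quot_piP w; rewrite -piD -!piM mulrDr piD.
Qed.

Lemma quot_one_neq0 : quot_one != 0.
Proof.
apply/eqP; have -> : 0 = quot_pi 0.
  by apply: (addIr (quot_pi 0)); rewrite -piD !add0r.
by move/quot_pi_eq; rewrite subr0 (negbTE ideal1_subproof).
Qed.

HB.instance Definition _ := GRing.Zmodule_isNzRing.Build Q
  quot_mulA quot_mul1 quot_mulr1 quot_mulDl quot_mulDr quot_one_neq0.

Lemma quot_scaleA c d u : quot_scale c (quot_scale d u) = quot_scale (c * d) u.
Proof. by have [x ->] := quot_piP u; rewrite -!piZ scalerA. Qed.

Lemma quot_scale1 u : quot_scale 1 u = u.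
Proof. by have [x ->] := quot_piP u; rewrite -piZ scale1r. Qed.

Lemma quot_scaleDr c u v :
  quot_scale c (u + v) = quot_scale c u + quot_scale c v.
Proof.
have [x ->] := quot_piP u; have [y ->] := quot_piP v.
by rewrite -piD -!piZ scalerDr piD.
Qed.

Lemma quot_scaleDl u c d :
  quot_scale (c + d) u = quot_scale c u + quot_scale d u.
Proof. by have [x ->] := quot_piP u; rewrite -!piZ scalerDl piD. Qed.

HB.instance Definition _ := GRing.Zmodule_isLmodule.Build K Q
  quot_scaleA quot_scale1 quot_scaleDr quot_scaleDl.

Lemma quot_pi_linear : linear quot_pi.
Proof. by move=> c x y; rewrite piD piZ. Qed.

HB.instance Definition _ :=
  GRing.isLinear.Build K A Q *:%R quot_pi quot_pi_linear.

Lemma quot_pi_monoid : monoid_morphism quot_pi.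
Proof. by split=> // x y; rewrite piM. Qed.

HB.instance Definition _ :=
  GRing.isMonoidMorphism.Build A Q quot_pi quot_pi_monoid.

Lemma quot_piZ c x : quot_pi (c *: x) = c *: quot_pi x.
Proof. exact: piZ. Qed.

Lemma quot_piM x y : quot_pi (x * y) = quot_pi x * quot_pi y.
Proof. exact: piM. Qed.

Lemma quot_scaleAl c u v : c *: (u * v) = (c *: u) * v.
Proof.
have [x ->] := quot_piP u; have [y ->] := quot_piP v.
by rewrite -(quot_piZ c x) -!quot_piM -quot_piZ scalerAl.
Qed.

Lemma quot_scaleAr c u v : c *: (u * v) = u * (c *: v).
Proof.
have [x ->] := quot_piP u; have [y ->] := quot_piP v.
by rewrite -(quot_piZ c y) -!quot_piM -quot_piZ scalerAr.
Qed.

HB.instance Definition _ := GRing.Lmodule_isLalgebra.Build K Q quot_scaleAl.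
HB.instance Definition _ := GRing.Lalgebra_isAlgebra.Build K Q quot_scaleAr.

End QuotientAlgebra.

(* The free associative algebra on [X]: an algebra with the words in [X] as a
   basis, multiplied by concatenation. It is realized as the monoid algebra of
   the free monoid on [X]. *)
Record free_alg (K : fieldType) (X : choiceType) := FreeAlg {
  free_sort :> algType K;
  free_word : seq X -> free_sort;
  free_word_nil : free_word [::] = 1;
  free_word_cat : {morph free_word : s t / s ++ t >-> s * t};
  free_ind : forall P : free_sort -> Prop,
    P 0 -> (forall (c : K) x y, P x -> P y -> P (c *: x + y)) ->
    (forall s, P (free_word s)) -> forall x, P x;
  free_ext : forall W : lmodType K, (seq X -> W) -> free_sort -> W;
  free_ext_linear : forall (W : lmodType K) (h : seq X -> W),
    linear (free_ext h);
  free_ext_word : forall (W : lmodType K) (h : seq X -> W) s,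
    free_ext h (free_word s) = h s
}.

Arguments free_word {K X f} s.
Arguments free_ext {K X f} W h x.

HB.instance Definition _ (K : fieldType) (X : choiceType) (F : free_alg K X)
    (W : lmodType K) (h : seq X -> W) :=
  GRing.isLinear.Build K F W *:%R (free_ext W h) (free_ext_linear h).

Definition free_malg (K : fieldType) (X : choiceType) : Type :=
  {malg K[{fmonom X}]}.

Section FreeAlgebra.
Context (K : fieldType) (X : choiceType).
Local Notation F := (free_malg K X).

HB.instance Definition _ := GRing.Lalgebra.on F.

Lemma malg_scaleAr (c : K) (x y : F) : c *: (x * y) = x * (c *: y).
Proof.
have Z (z : {malg K[{fmonom X}]}) : c *: z = z * << c *g mone >>.
  rewrite -mul_malgC !malgM_def fgmulUg fgmulgU.
  by apply: eq_bigr => k _; rewrite mulrC mul1m mulm1.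
by rewrite (Z (x * y)) (Z y) mulrA.
Qed.

HB.instance Definition _ := GRing.Lalgebra_isAlgebra.Build K F malg_scaleAr.

Let word (s : seq X) : F := << FMonom s >>.

Let word_nil : word [::] = 1.
Proof. by rewrite /word -fmoneE. Qed.

Let word_cat s t : word (s ++ t) = word s * word t.
Proof.
rewrite /word [RHS]malgM_def fgmulUU mulr1; congr mkmalgU.
by apply/eqP; rewrite fmP fmM.
Qed.

Let word_ind (P : F -> Prop) :
  P 0 -> (forall (c : K) x y, P x -> P y -> P (c *: x + y)) ->
  (forall s, P (word s)) -> forall x, P x.
Proof.
move=> P0 PD PU x; have -> : x = \sum_(k <- msupp x) x@_k *: word k.
  rewrite [LHS]monalgE; apply: eq_bigr => k _.
  by apply/malgP => k'; rewrite mcoeffZ !mcoeffU fmK mulrnAr mulr1.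
elim/big_rec: _ => //= k y _; exact: PD.
Qed.

Let ext (W : lmodType K) (h : seq X -> W) (x : F) : W :=
  \sum_(k <- msupp x) x@_k *: h k.

Let extw (W : lmodType K) (h : seq X -> W) (d : {fset {fmonom X}}) x :
  (msupp x `<=` d)%fset -> ext h x = \sum_(k <- d) x@_k *: h k.
Proof.
move=> le; rewrite /ext (big_fset_incl _ le) //= => r _ /mcoeff_outdom ->.
exact: scale0r.
Qed.

Let ext_linear (W : lmodType K) (h : seq X -> W) : linear (ext h).
Proof.
move=> c x y; pose d := (msupp x `|` msupp y)%fset.
rewrite (extw _ (fsubsetUl (msupp x) (msupp y) : (_ `<=` d)%fset)).
rewrite (extw _ (fsubsetUr (msupp x) (msupp y) : (_ `<=` d)%fset)).
have le : (msupp (c *: x + y) `<=` d)%fset.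
  apply: fsubset_trans (msuppD_le _ _) _.
  exact/fsetSU/(@msuppZ_le _ _ c (x : {malg K[{fmonom X}]})).
rewrite (extw _ le) scaler_sumr -big_split /=.
by apply: eq_bigr => r _; rewrite mcoeffD mcoeffZ scalerDl scalerA.
Qed.

Let ext_word (W : lmodType K) (h : seq X -> W) s : ext h (word s) = h s.
Proof. by rewrite (extw _ msuppU_le) big_seq_fset1 mcoeffUU scale1r. Qed.

Definition malg_free : free_alg K X :=
  @FreeAlg K X F word word_nil word_cat word_ind ext ext_linear ext_word.

End FreeAlgebra.

(* locked because unification failures in [{malg _[_]}] are very slow *)
Definition free_algebra (K : fieldType) (X : choiceType) : free_alg K X :=
  locked (malg_free K X).

Definition free_gen (K : fieldType) (X : choiceType) (v : X) :
  free_algebra K X := free_word [:: v].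

Inductive generated_ideal (R : nzRingType) (S : set R) : set R :=
| generated_ideal0 : generated_ideal S 0
| generated_ideal_gen x : S x -> generated_ideal S x
| generated_idealD x y :
    generated_ideal S x -> generated_ideal S y -> generated_ideal S (x + y)
| generated_idealM x y z :
    generated_ideal S y -> generated_ideal S (x * y * z).

Section Enveloping.
Context (K : fieldType) (g : lieSuperType K).
Local Notation F := (free_algebra K g).

Inductive env_relation : set F :=
| env_relation_linear (c : K) u v :
    env_relation (free_gen K (c *: u + v) - (c *: free_gen K u + free_gen K v))
| env_relation_bracket a b u v : homog a u -> homog b v ->
    env_relation (free_gen K u * free_gen K v
                    - (-1) ^+ (a && b) *: (free_gen K v * free_gen K u)
                    - free_gen K (sbracket u v)).

Definition env_ideal : {pred F} :=
  fun x => `[< generated_ideal env_relation x >].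

Lemma env_idealP x : reflect (generated_ideal env_relation x) (x \in env_ideal).
Proof. exact: asboolP. Qed.

Lemma env_ideal_zmod_closed : zmod_closed env_ideal.
Proof.
split=> [|x y /env_idealP hx /env_idealP hy]; apply/env_idealP.
  exact: generated_ideal0.
apply: generated_idealD => //; rewrite -[- y]mulr1 -mulN1r.
exact: generated_idealM.
Qed.

HB.instance Definition _ :=
  GRing.isZmodClosed.Build F env_ideal env_ideal_zmod_closed.

Lemma env_ideal1 : 1 \notin env_ideal.
Proof.
pose e : F -> K^o := free_ext K^o (fun s : seq g => (s == [::])%:R : K^o).
have eW s : e (free_word s) = (s == [::])%:R by apply: free_ext_word.
have eL (c : K) x y : e (c *: x + y) = c * e x + e y by apply: free_ext_linear.
have e0 : e 0 = 0 by apply: linear0.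
clearbody e.
have eD x y : e (x + y) = e x + e y by rewrite -[x]scale1r eL mul1r scale1r.
have eZ (c : K) x : e (c *: x) = c * e x by rewrite -[c *: x]addr0 eL e0 addr0.
have eN x : e (- x) = - e x by rewrite -scaleN1r eZ mulN1r.
have eM x y : e (x * y) = e x * e y.
  elim/free_ind: x => [|c x1 x2 h1 h2|s]; first by rewrite mul0r e0 mul0r.
    by rewrite mulrDl -scalerAl !eL h1 h2 mulrDl mulrA.
  elim/free_ind: y => [|c x1 x2 h1 h2|t]; first by rewrite mulr0 e0 mulr0.
    by rewrite mulrDr -scalerAr !eL h1 h2 mulrDr mulrCA.
  by rewrite -free_word_cat !eW -natrM mulnb; case: s.
have eG v : e (free_gen K v) = 0 by rewrite eW.
suff H x : generated_ideal env_relation x -> e x = 0.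
  apply/env_idealP => /H/eqP; rewrite -free_word_nil eW eqxx.
  by rewrite oner_eq0.
elim=> {x} [|x [c u v|a b u v _ _]|x y _ hx _ hy|x y z _ hy].
- exact: e0.
- by rewrite !(eD, eN, eZ) !eG mulr0 addr0 subr0.
- by rewrite !(eD, eN, eZ, eM) !eG !mulr0 !subr0.
- by rewrite eD hx hy addr0.
- by rewrite !eM hy mulr0 mul0r.
Qed.

Lemma env_idealM x y z : y \in env_ideal -> x * y * z \in env_ideal.
Proof. by move=> /env_idealP h; apply/env_idealP/generated_idealM. Qed.

HB.instance Definition _ :=
  isTwoSidedIdeal.Build F env_ideal env_ideal1 env_idealM.

Definition env : Type := alg_quot env_ideal.

HB.instance Definition _ := GRing.Algebra.on env.

Definition env_pi : F -> env := @quot_pi K F env_ideal.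

HB.instance Definition _ := GRing.Linear.on env_pi.
HB.instance Definition _ := GRing.RMorphism.on env_pi.

Definition env_inj (v : g) : env := env_pi (free_gen K v).

Lemma env_pi_eq x y :
  env_pi x = env_pi y <-> generated_ideal env_relation (x - y).
Proof. by split=> [/quot_pi_eq/env_idealP|/env_idealP/quot_pi_eq]. Qed.

Lemma env_piP (u : env) : exists x, u = env_pi x.
Proof. exact: quot_piP. Qed.

Lemma env_inj_linear : linear env_inj.
Proof.
move=> c u v; rewrite /env_inj -linearP.
exact/env_pi_eq/generated_ideal_gen/env_relation_linear.
Qed.

HB.instance Definition _ :=
  GRing.isLinear.Build K g env *:%R env_inj env_inj_linear.

Lemma env_inj_bracket a b u v : homog a u -> homog b v ->
  env_inj (sbracket u v) =
    env_inj u * env_inj v - (-1) ^+ (a && b) *: (env_inj v * env_inj u).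
Proof.
move=> hu hv; rewrite /env_inj -!rmorphM -linearZ -linearB.
exact/esym/env_pi_eq/generated_ideal_gen/env_relation_bracket.
Qed.

(* The component of parity [b] of a word [v1 ... vn] is the sum of the words
   [v1' ... vn'] where each [vi'] is a homogeneous component of [vi] and the
   parities of the [vi'] add up to [b]. *)
Fixpoint word_part (b : bool) (s : seq g) : env :=
  if s is v :: s' then
    \sum_(a : bool) env_inj (spart a v) * word_part (b (+) a) s'
  else if b then 0 else 1.

Definition env_part (b : bool) (u : env) : env :=
  free_ext env (word_part b) (repr u).

Let extE (W : lmodType K) (f : {linear F -> W}) :
  (forall x, generated_ideal env_relation x -> f x = 0) ->
  forall x, f (repr (env_pi x)) = f x.
Proof.
move=> f0 x; apply/eqP; rewrite -subr_eq0 -linearB; apply/eqP/f0/env_pi_eq.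
by rewrite /env_pi /quot_pi reprK.
Qed.

Let p b : {linear F -> env} := free_ext env (word_part b).

Let pW b s : p b (free_word s) = word_part b s.
Proof. exact: free_ext_word. Qed.

Let p1 b : p b 1 = if b then 0 else 1.
Proof. by rewrite -free_word_nil pW. Qed.

Let pG b v : p b (free_gen K v) = env_inj (spart b v).
Proof.
rewrite pW /= big_bool; case: b => /=;
by rewrite mulr1 mulr0 ?addr0 ?add0r.
Qed.

Let pM b x y : p b (x * y) = \sum_(a : bool) p a x * p (b (+) a) y.
Proof.
elim/free_ind: x => [|c x1 x2 h1 h2|s].
- by rewrite mul0r linear0 big1 // => a _; rewrite linear0 mul0r.
- rewrite mulrDl -scalerAl linearP h1 h2 scaler_sumr -big_split /=.
  by apply: eq_bigr => a _; rewrite linearP mulrDl scalerAl.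
elim/free_ind: y => [|c x1 x2 h1 h2|t].
- by rewrite mulr0 linear0 big1 // => a _; rewrite linear0 mulr0.
- rewrite mulrDr -scalerAr linearP h1 h2 scaler_sumr -big_split /=.
  by apply: eq_bigr => a _; rewrite linearP mulrDr scalerAr.
rewrite -free_word_cat pW.
under eq_bigr do rewrite !pW.
elim: s b => [|v s IH] b /=.
  by rewrite big_bool /= mul0r add0r mul1r addbF.
under eq_bigr => a _ do rewrite IH mulr_sumr.
under [RHS]eq_bigr => a _ do rewrite mulr_suml.
rewrite !big_bool /= !mulrA.
by case: b => /=; rewrite [X in X + _]addrC addrACA.
Qed.

Let p_ideal b x : generated_ideal env_relation x -> p b x = 0.
Proof.
move=> hx; elim: hx b => {x}
  [|x [c u v|a a' u v hu hv]|x y _ hx _ hy|x y z _ hy] b.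
- exact: linear0.
- rewrite linearB linearD linearZ /= !pG linearP linearP subrr //.
- rewrite !linearB linearZ /= !pM !pG (homog_spart _ (sbracket_homog _ _ _ _ hu hv)).
  under eq_bigr do rewrite !pG (homog_spart _ hu) (homog_spart _ hv).
  under [X in _ - _ *: X - _]eq_bigr do
    rewrite !pG (homog_spart _ hu) (homog_spart _ hv).
  have H := env_inj_bracket hu hv.
  rewrite !big_bool /=.
  case: a hu H => hu H; case: a' hv H => hv H; case: b => /=;
  rewrite ?linear0 ?mul0r ?mulr0 ?addr0 ?add0r ?scaler0 ?subr0 ?H ?subrr ?oppr0 //.
- by rewrite linearD hx hy addr0.
- rewrite pM big1 // => a _; rewrite pM big1 ?mul0r // => a' _.
  by rewrite hy mulr0.
Qed.

Let partE b x : env_part b (env_pi x) = p b x.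
Proof. exact/(extE (f := p b))/p_ideal. Qed.

Lemma env_part_linear b : linear (env_part b).
Proof.
move=> c u v; have [x ->] := env_piP u; have [y ->] := env_piP v.
by rewrite -linearP !partE linearP.
Qed.

Let partD b u v : env_part b (u + v) = env_part b u + env_part b v.
Proof. by have := env_part_linear b 1 u v; rewrite !scale1r. Qed.

Let part0 b : env_part b 0 = 0.
Proof. by apply: (addIr (env_part b 0)); rewrite -partD !add0r. Qed.

Let partM b u v :
  env_part b (u * v) = \sum_(a : bool) env_part a u * env_part (b (+) a) v.
Proof.
have [x ->] := env_piP u; have [y ->] := env_piP v.
rewrite -rmorphM partE pM.
by apply: eq_bigr => a _; rewrite !partE.
Qed.

Let part1 b : env_part b 1 = if b then 0 else 1.
Proof. by rewrite -[in LHS](rmorph1 env_pi) partE p1. Qed.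

Lemma env_part_inj b v : env_part b (env_inj v) = env_inj (spart b v).
Proof. by rewrite partE pG. Qed.

Lemma env_ind (P : env -> Prop) :
  P 0 -> (forall (c : K) u v, P u -> P v -> P (c *: u + v)) ->
  P 1 -> (forall v u, P u -> P (env_inj v * u)) ->
  forall u, P u.
Proof.
move=> P0 PD P1 PM u; have [x ->] := env_piP u.
elim/free_ind: x => [|c x y hx hy|s]; first by rewrite linear0.
  by rewrite linearP; apply: PD.
elim: s => [|v s IH]; first by rewrite free_word_nil rmorph1.
by rewrite -cat1s free_word_cat rmorphM; apply: PM.
Qed.

Lemma env_partK a b u :
  env_part a (env_part b u) = if a == b then env_part b u else 0.
Proof.
elim/env_ind: u a b => [|c u v hu hv||v u hu] a b.
- by rewrite !part0 if_same.
- rewrite !env_part_linear hu hv; case: ifP => // _.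
  by rewrite scaler0 addr0.
- by rewrite part1; case: a b => -[]; rewrite /= ?part0 ?part1.
rewrite [env_part b _]partM [in LHS]big_bool partD !partM !big_bool /=.
rewrite !env_part_inj !hu !spartK.
by case: a; case: b => /=;
  rewrite ?linear0 ?mul0r ?mulr0 ?addr0 ?add0r.
Qed.

Lemma env_part_sum u : env_part false u + env_part true u = u.
Proof.
elim/env_ind: u => [|c u v hu hv||v u hu].
- by rewrite !part0 addr0.
- by rewrite !env_part_linear addrACA -scalerDr hu hv.
- by rewrite !part1 addr0.
rewrite !partM !big_bool /= !env_part_inj addrACA -!mulrDr hu.
rewrite (addrC (env_part true u)) hu -mulrDl -linearD.
by rewrite (addrC (spart true v)) spart_sum.
Qed.

HB.instance Definition _ := Lmodule_isSuper.Build K env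
  env_part_linear env_partK env_part_sum.

Lemma env_homog1 : homog false (1 : env).
Proof. exact: part1. Qed.

Lemma env_homogM a b (u v : env) : homog a u -> homog b v ->
  homog (a (+) b) (u * v).
Proof.
move=> hu hv; rewrite /homog [LHS]partM.
have sE c w : env_part c w = spart c w by [].
under eq_bigr do rewrite !sE (homog_spart _ hu) (homog_spart _ hv).
rewrite big_bool; case: a hu => _; case: b hv => _ /=;
by rewrite ?mul0r ?mulr0 ?addr0 ?add0r.
Qed.

HB.instance Definition _ := isSuperAlgebra.Build K env env_homog1 env_homogM.

Lemma env_inj_homog a v : homog a v -> homog a (env_inj v).
Proof. by move=> hv; rewrite /homog [LHS]env_part_inj hv. Qed.

Theorem env_universal (A : superAlgType K) (f : g -> A) :
  linear f -> (forall a v, homog a v -> homog a (f v)) ->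
  (forall u v, f (sbracket u v) = supercomm (f u) (f v)) ->
  exists phi : env -> A,
    [/\ linear phi, monoid_morphism phi, forall v, phi (env_inj v) = f v
      & forall a u, homog a u -> homog a (phi u)].
Proof.
move=> fL fH fB.
have fP c u v : f (c *: u + v) = c *: f u + f v by apply: fL.
pose q : {linear F -> A} := free_ext A (fun s => \prod_(v <- s) f v).
have qW s : q (free_word s) = \prod_(v <- s) f v by apply: free_ext_word.
have qG v : q (free_gen K v) = f v by rewrite qW big_seq1.
have q1 : q 1 = 1 by rewrite -free_word_nil qW big_nil.
have qM x y : q (x * y) = q x * q y.
  elim/free_ind: x => [|c x1 x2 h1 h2|s]; first by rewrite mul0r linear0 mul0r.
    by rewrite mulrDl -scalerAl !linearP h1 h2 mulrDl scalerAl.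
  elim/free_ind: y => [|c x1 x2 h1 h2|t]; first by rewrite mulr0 linear0 mulr0.
    by rewrite mulrDr -scalerAr !linearP h1 h2 mulrDr scalerAr.
  by rewrite -free_word_cat !qW big_cat.
have q0 x : generated_ideal env_relation x -> q x = 0.
  elim=> {x} [|x [c u v|a b u v hu hv]|x y _ hx _ hy|x y z _ hy].
  - exact: linear0.
  - by rewrite linearB linearD linearZ /= !qG fP subrr.
  - rewrite !linearB linearZ /= !qM !qG fB.
    by rewrite (supercomm_homog (fH _ _ hu) (fH _ _ hv)) subrr.
  - by rewrite linearD hx hy addr0.
  - by rewrite !qM hy mulr0 mul0r.
pose phi (u : env) : A := q (repr u).
have phiE x : phi (env_pi x) = q x by apply: extE.
have phiL : linear phi.
  move=> c u v; have [x ->] := env_piP u; have [y ->] := env_piP v.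
  by rewrite -linearP !phiE linearP.
have phiM u v : phi (u * v) = phi u * phi v.
  have [x ->] := env_piP u; have [y ->] := env_piP v.
  by rewrite -rmorphM !phiE qM.
have phi1 : phi 1 = 1 by rewrite -[in LHS](rmorph1 env_pi) phiE.
have phi0 : phi 0 = 0 by rewrite -[in LHS](linear0 env_pi) phiE linear0.
have phiD u v : phi (u + v) = phi u + phi v.
  by rewrite -[u]scale1r phiL !scale1r.
have phiG v : phi (env_inj v) = f v by rewrite phiE qG.
exists phi; split=> // a u hu.
rewrite /homog -{2}hu => {hu}.
elim/env_ind: u a => [|c u v hu hv||v u hu] a.
- by rewrite !(phi0, spart0).
- by rewrite spartD spartZ !phiL spartD spartZ hu hv.
- rewrite phi1 (homog_spart a (@homog1 K A)) (homog_spart a (@homog1 K env)).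
  by case: eqP; rewrite ?phi1 ?phi0.
have sM (B : superAlgType K) (x y : B) b :
    spart b (x * y) = \sum_(d : bool) spart d x * spart (b (+) d) y.
  rewrite -{1}[x]spart_sumb -{1}[y]spart_sumb !big_bool /=.
  rewrite !mulrDl !mulrDr !spartD.
  have hM d e := homog_spart b (homogM _ _ _ _ (spart_homog d x) (spart_homog e y)).
  by rewrite !hM; case: b {hM} => /=; rewrite ?addr0 ?add0r.
rewrite phiM !sM !big_bool /= phiD !phiM phiG.
have fS d w : spart d (f w) = f (spart d w).
  have fD x y : f (x + y) = f x + f y by rewrite -[x]scale1r fP !scale1r.
  rewrite -{1}[w]spart_sumb big_bool fD spartD.
  rewrite (homog_spart d (fH _ _ (spart_homog true w))).
  rewrite (homog_spart d (fH _ _ (spart_homog false w))).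
  by case: d; rewrite ?addr0 ?add0r.
have iS d w : spart d (env_inj w) = env_inj (spart d w) by apply: env_part_inj.
by rewrite !fS !hu !iS !phiG.
Qed.

Lemma env_universal_uniq (A : superAlgType K) (phi psi : env -> A) :
  linear phi -> monoid_morphism phi -> linear psi -> monoid_morphism psi ->
  (forall v, phi (env_inj v) = psi (env_inj v)) -> phi =1 psi.
Proof.
move=> hL [h1 hM] kL [k1 kM] e; elim/env_ind => [|c u v hu hv||v u hu].
- have z (r : env -> A) : linear r -> r 0 = 0.
    move=> rL; have := rL (-1) 0 0.
    by rewrite scaler0 addr0 !scaleN1r addNr.
  by rewrite !z.
- by rewrite hL kL hu hv.
- by rewrite h1 k1.
- by rewrite hM kM e hu.
Qed.

End Enveloping.

Definition enveloping_superalgebra (K : fieldType) (g : lieSuperType K) :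
  superAlgType K := env g.

(* Main.v *)
(* The center of [l] is an abelian graded ideal, so semisimplicity makes it
   trivial.

   Let [z] be central in [U(g)], a combination of words of length at most
   [n >= 1] in [g]. A matrix coefficient of the adjoint representation acts on
   [U(g)] through the coproduct; if it vanishes on [1] and restricts to
   [phi] on [g], then it induces on symbols the partial derivative along [phi].
   Take [x = e (x) X^s] with [s] so large that the commutators [[x, y]], [y] a
   letter of [z], have degrees that do not occur in [z], and [phi] supported in
   one such degree. Applying the operator to [[x, z] = 0] shows that the
   derivative of [z] along [y |-> phi [x, y]] has length at most [n - 2].
   As the center of [l] is trivial, the functionals [y |-> phi [x, y]] separate
   the points of [g], so the Euler identity [n z = sum_j c_j (d z / d phi_j)],
   valid up to words of length at most [n - 1], shortens [z] because [n] is
   invertible in [K]. This bypasses the Poincare-Birkhoff-Witt theorem. *)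
From HB Require Import structures.
Require Import Defs.
From mathcomp Require Import all_boot all_order all_algebra.
From mathcomp Require Import finmap monalg boolp.
From mathcomp Require Import classical_sets.

Set Implicit Arguments.
Unset Strict Implicit.
Unset Printing Implicit Defensive.

Import GRing.Theory.
Local Open Scope ring_scope.
Local Open Scope classical_set_scope.

(** * Separating linear functionals *)

Section Functionals.
Context (K : fieldType) (V : lmodType K).
Implicit Types (x y v : V) (phi psi : V -> K).

(* [x |-> a] is read off [x - a *: v \in S], where [S] is a subspace maximal
   among those avoiding [v], hence a hyperplane. *)
Lemma exists_functional v : v <> 0 -> exists2 phi, scalar phi & phi v <> 0.
Proof.
move=> v0.
pose P (S : set V) :=
  (forall (c : K) x y, S x -> S y -> S (c *: x + y)) /\ ~ S v.
have [F FP Ftot|S [[SL Sv] Smax]] := @Zorn_bigcup V P.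
  split=> [c x y [X FX Xx] [Y FY Yy]|[X FX Xv]]; last by case: (FP _ FX).
  have [XY|YX] := Ftot _ _ FX FY.
    by exists Y => //; apply: (proj1 (FP _ FY)) => //; apply: XY.
  by exists X => //; apply: (proj1 (FP _ FX)) => //; apply: YX.
(* [P] admits the empty set, the union of an empty chain, so [0] lies in [S] by maximality only. *)
have S0 : S 0.
  have [[x Sx]|nS] := pselect (exists x, S x).
    by have := SL (-1) x x Sx Sx; rewrite scaleN1r addNr.
  exfalso; suff : P [set 0].
    apply: Smax; split=> [x Sx|]; first by case: nS; exists x.
    by move/(_ 0 erefl) => S0; apply: nS; exists 0.
  split=> [c x y -> ->|v00]; first by rewrite scaler0 addr0.
  exact: v0.
have SZ c x : S x -> S (c *: x) by move=> Sx; rewrite -[_ *: _]addr0; apply: SL.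
have SD x y : S x -> S y -> S (x + y).
  by move=> Sx Sy; rewrite -[x]scale1r; apply: SL.
(* Otherwise [S + K x] still avoids [v]; maximality then puts [x] in [S], and [a = 0] works. *)
have ex x : exists a : K, S (x - a *: v).
  apply: contrapT => nx.
  pose S' : set V := [set y | exists b : K, S (y - b *: x)].
  suff : P S'.
    apply: Smax; split=> [y Sy|]; first by exists 0; rewrite scale0r subr0.
    move=> S'S; apply: nx; exists 0; rewrite scale0r subr0; apply: S'S.
    by exists 1; rewrite scale1r subrr.
  split=> [c y1 y2 [b1 h1] [b2 h2]|[b h]].
    exists (c * b1 + b2).
    have -> : c *: y1 + y2 - (c * b1 + b2) *: x =
              c *: (y1 - b1 *: x) + (y2 - b2 *: x).
      by rewrite scalerBr scalerDl opprD scalerA addrACA.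
    exact: SL.
  have [b0|b0] := eqVneq b 0; first by move: h; rewrite b0 scale0r subr0.
  apply: nx; exists b^-1.
  have -> : x - b^-1 *: v = (- b^-1) *: (v - b *: x).
    by rewrite scalerBr scalerA mulNr mulVf // scaleNr scaleN1r opprK addrC.
  exact: SZ.
have uniq a b x : S (x - a *: v) -> S (x - b *: v) -> a = b.
  move=> ha hb; apply/eqP; rewrite -subr_eq0; apply: contra_notT Sv => ab.
  have := SL (a - b)^-1 _ _ (SL (-1) _ _ ha hb) S0.
  rewrite addr0 scaleN1r opprB addrA subrK -scalerBl.
  by rewrite scalerA mulVf // scale1r.
pose phi x := sval (cid (ex x)).
have phiP x : S (x - phi x *: v) := svalP (cid (ex x)).
exists phi => [c x y|p0].
  apply: uniq (phiP _) _.
  have -> : c *: x + y - (c * phi x + phi y) *: v =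
            c *: (x - phi x *: v) + (y - phi y *: v).
    by rewrite scalerBr scalerDl opprD scalerA addrACA.
  exact: SL.
by apply: Sv; have := phiP v; rewrite p0 scale0r subr0.
Qed.

Lemma scalar_fun0 phi : scalar phi -> phi 0 = 0.
Proof.
by move=> h; have := h (-1) 0 0; rewrite scaler0 addr0 mulN1r addNr.
Qed.

Lemma scalar_funZ phi c x : scalar phi -> phi (c *: x) = c * phi x.
Proof. by move=> h; rewrite -[c *: x]addr0 h scalar_fun0 // addr0. Qed.

Lemma scalar_funD phi x y : scalar phi -> phi (x + y) = phi x + phi y.
Proof. by move=> h; rewrite -[x]scale1r h !scale1r mul1r. Qed.

(* The identity is a finite sum of rank one operators [phi _ *: c] on the span
   of [s]: this plays the role of a pair of dual bases without requiring linear
   independence of [s]. *)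
Lemma separating_dual (Phi : set (V -> K)) (s : seq V) :
  (forall phi, Phi phi -> scalar phi) ->
  (forall (c : K) phi psi, Phi phi -> Phi psi ->
    Phi (fun x => c * phi x + psi x)) ->
  (forall x, x <> 0 -> exists2 phi, Phi phi & phi x <> 0) ->
  exists n (phi : 'I_n -> V -> K) (b : 'I_n -> V),
    (forall i, Phi (phi i)) /\
    (forall x, x \in s -> \sum_i phi i x *: b i = x).
Proof.
move=> PhiL PhiD PhiS; elim: {s}(size s) {-2}s (eqxx (size s)) => [|m IH] s.
  by rewrite size_eq0 => /eqP->; exists 0%N, (fun _ _ => 0), (fun _ => 0); split=> [[]|].
case: s => // v s /eqP[sm].
have [v0|/eqP/PhiS[phi0 Pphi0 /eqP phiv]] := eqVneq v 0.
  have [n [phi [b [Pphi Hb]]]] := IH s (introT eqP sm); exists n, phi, b.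
  split=> // x; rewrite inE => /predU1P[->|]; last exact: Hb.
  by rewrite v0 big1 // => i _; rewrite scalar_fun0 ?scale0r //; apply: PhiL.
(* Normalized so that [x - psi0 x *: v] is a projection killing [v]; the induction hypothesis is
   applied to the projected vectors. *)
pose psi0 x := (phi0 v)^-1 * phi0 x.
have Ppsi0 : Phi psi0.
  suff -> : psi0 = (fun x => ((phi0 v)^-1 - 1) * phi0 x + phi0 x) by exact: PhiD.
  by apply/funext => x; rewrite mulrBl mul1r subrK.
have psi0v : psi0 v = 1 by rewrite /psi0 mulVf.
have [|n [phi [b [Pphi Hb]]]] := IH [seq x - psi0 x *: v | x <- s].
  by rewrite size_map; apply/eqP.
(* Apart from [psi0], these are the [phi j] precomposed with that projection. *)
pose psi i x :=
  if unlift ord0 i is Some j then - phi j v * psi0 x + phi j x else psi0 x.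
exists n.+1, psi, (fun i => if unlift ord0 i is Some j then b j else v).
split=> [i|x].
  by rewrite /psi; case: unliftP => [j _|_] //; apply: PhiD.
rewrite big_ord_recl /psi unlift_none.
under eq_bigr => j _ do rewrite liftK.
have Z j a y : phi j (a *: y) = a * phi j y by apply: scalar_funZ; apply: PhiL.
rewrite inE => /predU1P[->|xs].
  rewrite psi0v scale1r big1 ?addr0 // => j _.
  by rewrite mulr1 addNr scale0r.
have /Hb : x - psi0 x *: v \in [seq x - psi0 x *: v | x <- s] by apply: map_f.
move=> Hx; rewrite addrC -[RHS](subrK (psi0 x *: v)) -Hx; congr (_ + _).
apply: eq_bigr => j _; congr (_ *: _).
rewrite scalar_funD; last exact: PhiL.
by rewrite -scaleNr Z addrC mulNr mulNr mulrC.
Qed.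

End Functionals.

(** * Signs and brackets *)

Section Twist.
Context (K : fieldType).

(** The Koszul sign of moving [v] past an element of parity [a], extended linearly to inhomogeneous
    [v]. *)
Definition twist (V : superLmodType K) (a : bool) (v : V) : V :=
  spart false v + (-1) ^+ a *: spart true v.

Lemma twist_linear (V : superLmodType K) a : linear (@twist V a).
Proof.
move=> c u v; rewrite /twist !spartD !spartZ !scalerDr !scalerA (mulrC _ c).
by rewrite addrACA.
Qed.

HB.instance Definition _ (V : superLmodType K) a :=
  GRing.isLinear.Build K V V *:%R (@twist V a) (@twist_linear V a).

Lemma twistD (V : superLmodType K) a (u v : V) :
  twist a (u + v) = twist a u + twist a v.
Proof. exact: linearD. Qed.

Lemma twistZ (V : superLmodType K) a c (v : V) :
  twist a (c *: v) = c *: twist a v.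
Proof. exact: linearZ. Qed.

Lemma twist_homog (V : superLmodType K) a b (v : V) :
  homog b v -> twist a v = (-1) ^+ (a && b) *: v.
Proof.
move=> hv; rewrite /twist !(homog_spart _ hv).
by case: a; case: b {hv} => /=; rewrite ?scaler0 ?addr0 ?add0r // scale1r.
Qed.

Lemma twistK (V : superLmodType K) a b (v : V) :
  twist a (twist b v) = twist (a (+) b) v.
Proof.
rewrite {2}/twist twistD twistZ !(twist_homog _ (spart_homog _ _)).
by rewrite andbF andbT scale1r scalerA /twist signr_addb mulrC.
Qed.

Lemma twistF (V : superLmodType K) (v : V) : twist false v = v.
Proof. by rewrite /twist scale1r spart_sum. Qed.

Lemma mul_spart (A : superAlgType K) a b (x y : A) :
  homog a x -> spart b (x * y) = x * spart (a (+) b) y.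
Proof.
move=> hx; rewrite -{1}(spart_sum y) mulrDr spartD.
rewrite !(homog_spart b (homogM _ _ _ _ hx (spart_homog _ y))).
by case: a {hx}; case: b => /=; rewrite ?addr0 ?add0r.
Qed.

Lemma twist_homogM (A : superAlgType K) a b (x y : A) :
  homog a x -> twist b (x * y) = (-1) ^+ (b && a) *: (x * twist b y).
Proof.
move=> hx; rewrite /twist !(mul_spart _ _ hx) mulrDr -scalerAr.
case: a hx => hx; case: b => /=; rewrite ?expr1 ?scale1r //.
  by rewrite !scaleN1r opprB addrC.
by rewrite addrC.
Qed.

Lemma twistM (A : superAlgType K) b (x y : A) :
  twist b (x * y) = twist b x * twist b y.
Proof.
rewrite -{1}(spart_sum x) mulrDl twistD.
rewrite !(twist_homogM _ _ (spart_homog _ _)) andbF andbT scale1r.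
by rewrite scalerAl -mulrDl.
Qed.

Lemma supercenter_twist (A : superAlgType K) b (z y : A) :
  supercenter A z -> homog b y -> y * z = twist b z * y.
Proof.
move=> /(_ y); rewrite /supercomm big_bool => + hy.
rewrite !big_bool !(homog_spart _ hy) /= => H.
have {}H : z * y = y * twist b z.
  apply/eqP; rewrite -subr_eq0 -H -{1}(spart_sum z) /twist; apply/eqP.
  case: b {H} hy => _ /=; rewrite ?mulr0 ?mul0r ?scaler0 ?subr0 ?addr0 ?add0r;
  by rewrite ?expr0 ?scale1r mulrDl mulrDr opprD addrACA addrC -?scalerAr.
(* Twisting by [b] moves the twist to the left factor; the sign contributed by [y] occurs on both
   sides and cancels. *)
have := congr1 (twist b) H; rewrite !twistM twistK addbb twistF.
rewrite (twist_homog _ hy) -scalerAr -scalerAl => /(congr1 ( *:%R ((-1) ^+ (b && b)))).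
by rewrite !scalerA -signr_addb addbb !scale1r => ->.
Qed.

End Twist.

Section Bracket.
Context (K : fieldType) (g : lieSuperType K).
Implicit Types (u v w x y : g).

Lemma sbracketDl u v w : sbracket (u + v) w = sbracket u w + sbracket v w.
Proof. by have := sbracket_linear_l w 1 u v; rewrite /= !scale1r. Qed.

Lemma sbracketDr u v w : sbracket u (v + w) = sbracket u v + sbracket u w.
Proof. by have := sbracket_linear_r u 1 v w; rewrite /= !scale1r. Qed.

Lemma sbracket0l w : sbracket (0 : g) w = 0.
Proof. by apply: (addIr (sbracket 0 w)); rewrite -sbracketDl !add0r. Qed.

Lemma sbracket0r w : sbracket w (0 : g) = 0.
Proof. by apply: (addIr (sbracket w 0)); rewrite -sbracketDr !add0r. Qed.

Lemma sbracketZl (c : K) u w : sbracket (c *: u) w = c *: sbracket u w.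
Proof.
by have := sbracket_linear_l w c u 0; rewrite /= !addr0 sbracket0l addr0.
Qed.

Lemma sbracketZr (c : K) u w : sbracket w (c *: u) = c *: sbracket w u.
Proof.
by have := sbracket_linear_r w c u 0; rewrite /= !addr0 sbracket0r addr0.
Qed.

Lemma twist_bracket a u v :
  twist a (sbracket u v) = sbracket (twist a u) (twist a v).
Proof.
have H b c (u' v' : g) : homog b u' -> homog c v' ->
    twist a (sbracket u' v') = sbracket (twist a u') (twist a v').
  move=> hu hv; rewrite (twist_homog _ (sbracket_homog _ _ _ _ hu hv)).
  rewrite (twist_homog _ hu) (twist_homog _ hv) sbracketZl sbracketZr scalerA.
  by rewrite -signr_addb; case: a.
rewrite -{1}(spart_sum u) -{1}(spart_sum v) sbracketDl !sbracketDr !twistD.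
rewrite !(H _ _ _ _ (spart_homog _ _) (spart_homog _ _)).
by rewrite -!sbracketDr -sbracketDl -!twistD !spart_sum.
Qed.

(** For the right adjoint action no sign depends on [w], so linearity reduces to homogeneous [w],
    where skew symmetry applies to the left Jacobi identity. *)
Lemma sbracket_jacobi_r a b w u v : homog a u -> homog b v ->
  sbracket w (sbracket u v) = sbracket (sbracket w u) v
    - (-1) ^+ (a && b) *: sbracket (sbracket w v) u.
Proof.
move=> hu hv.
have H c (w' : g) : homog c w' -> sbracket w' (sbracket u v) =
    sbracket (sbracket w' u) v - (-1) ^+ (a && b) *: sbracket (sbracket w' v) u.
  move=> hw; rewrite (sbracket_jacobi _ _ _ _ _ hw hu); congr (_ + _).
  rewrite (sbracket_skew _ _ _ _ hu (sbracket_homog _ _ _ _ hw hv)).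
  rewrite scalerN scalerA -signr_addb; congr (- (_ *: _)).
  by case: a {hu}; case: c {hw}; case: b {hv}.
rewrite -(spart_sum w) !sbracketDl !(H _ _ (spart_homog _ _)).
by rewrite scalerDr opprD addrACA.
Qed.

Lemma env_injD u v : env_inj (u + v) = env_inj u + env_inj v.
Proof. exact: linearD. Qed.

Lemma env_injZ (c : K) u : env_inj (c *: u) = c *: env_inj u.
Proof. exact: linearZ. Qed.

Lemma env_inj_swap a u v : homog a v ->
  env_inj u * env_inj v = env_inj v * env_inj (twist a u) + env_inj (sbracket u v).
Proof.
move=> hv.
have H b (u' : g) : homog b u' -> env_inj u' * env_inj v =
    env_inj v * env_inj (twist a u') + env_inj (sbracket u' v).
  move=> hu; rewrite (env_inj_bracket hu hv) (twist_homog _ hu) linearZ /=.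
  by rewrite -scalerAr (andbC b) addrC subrK.
rewrite -{1}(spart_sum u) env_injD mulrDl.
rewrite !(H _ _ (spart_homog _ _)).
by rewrite addrACA -mulrDr -!env_injD -twistD -sbracketDl !spart_sum.
Qed.

Definition env_ad (b : bool) (y : g) (u : env g) : env g :=
  env_inj y * u - twist b u * env_inj y.

Lemma env_ad1 b y : env_ad b y 1 = 0.
Proof.
by rewrite /env_ad (twist_homog _ (env_homog1 g)) andbF scale1r mulr1 mul1r subrr.
Qed.

Lemma env_ad0 b y : env_ad b y 0 = 0.
Proof. by rewrite /env_ad linear0 mulr0 mul0r subrr. Qed.

Lemma env_adD b y (u v : env g) : env_ad b y (u + v) = env_ad b y u + env_ad b y v.
Proof. by rewrite /env_ad twistD mulrDr mulrDl opprD addrACA. Qed.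

Lemma env_adZ b y (c : K) (u : env g) : env_ad b y (c *: u) = c *: env_ad b y u.
Proof. by rewrite /env_ad twistZ -scalerAr -scalerAl scalerBr. Qed.

Lemma env_adM a b x y (u : env g) : homog b y -> homog a x ->
  env_ad b y (env_inj x * u) = env_inj (sbracket y x) * u
    + (-1) ^+ (b && a) *: (env_inj x * env_ad b y u).
Proof.
move=> hy hx; rewrite /env_ad (env_inj_bracket hy hx).
rewrite (twist_homogM _ _ (env_inj_homog hx)) -scalerAl !mulrBr mulrBl scalerBr.
by rewrite -!scalerAl !mulrA addrA subrK.
Qed.

Lemma supercenter_ad b y (z : env g) :
  supercenter (enveloping_superalgebra g) z -> homog b y -> env_ad b y z = 0.
Proof.
move=> hz hy; rewrite /env_ad (supercenter_twist hz (env_inj_homog hy)).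
exact: subrr.
Qed.

End Bracket.

(** * Matrix coefficients acting on the enveloping algebra *)

Section Hit.
Context (K : fieldType) (g : lieSuperType K) (c : bool).
Local Notation U := (env g).
Local Notation F := (free_algebra K g).
Implicit Types (f h : g -> U) (w y : g) (s : seq g).

(** For [f = D u] this is to be [D (y u)]: as [y] is primitive for the coproduct, it either acts on
    [w] or stays as a factor, with the signs of passing [w] and a functional of parity [c]. *)
Definition letter_act y f w : U :=
  f (sbracket w y)
  + \sum_(a : bool) (-1) ^+ (a && c) *: (env_inj (spart a y) * f (twist a w)).

Definition word_act s f : g -> U := foldr letter_act f s.

Lemma letter_act_homog a y f w : homog a y ->
  letter_act y f w =
    f (sbracket w y) + (-1) ^+ (a && c) *: (env_inj y * f (twist a w)).
Proof.
move=> hy; rewrite /letter_act (bigD1 a) //= big1 ?addr0 ?hy // => b nb.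
by rewrite (homog_spart _ hy) (negbTE nb) linear0 mul0r scaler0.
Qed.

Lemma letter_act_comb (d : K) y f h w :
  letter_act y (fun x => d *: f x + h x) w =
    d *: letter_act y f w + letter_act y h w.
Proof.
rewrite /letter_act scalerDr addrACA scaler_sumr -big_split /=; congr (_ + _).
apply: eq_bigr => a _; rewrite mulrDr scalerDr -scalerAr !scalerA.
by rewrite (mulrC d).
Qed.

Lemma letter_act_linear y f : linear f -> linear (letter_act y f).
Proof.
move=> fL d u v; rewrite /letter_act sbracketDl sbracketZl fL.
rewrite scalerDr addrACA scaler_sumr -big_split /=; congr (_ + _).
apply: eq_bigr => a _; rewrite twistD twistZ fL mulrDr scalerDr -scalerAr !scalerA.
by rewrite (mulrC d).
Qed.

Lemma letter_act_letterD (d : K) y z f w : linear f ->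
  letter_act (d *: y + z) f w = d *: letter_act y f w + letter_act z f w.
Proof.
move=> fL; rewrite /letter_act sbracketDr sbracketZr fL.
rewrite scalerDr addrACA scaler_sumr -big_split /=; congr (_ + _).
apply: eq_bigr => a _; rewrite spartD spartZ env_injD env_injZ.
by rewrite mulrDl scalerDr -scalerAl !scalerA (mulrC d).
Qed.

(** This lets the action descend from words to [U]. The right Jacobi identity treats the terms where
    both letters act on [w]; the mixed terms cancel in pairs. *)
Lemma letter_act_bracket a b y z f w : linear f -> homog a y -> homog b z ->
  letter_act y (letter_act z f) w
    - (-1) ^+ (a && b) *: letter_act z (letter_act y f) w
    = letter_act (sbracket y z) f w.
Proof.
move=> fL hy hz.
have fD u v : f (u + v) = f u + f v by rewrite -[u]scale1r fL !scale1r.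
have f0 : f 0 = 0 by apply: (addIr (f 0)); rewrite -fD !add0r.
have fZ d u : f (d *: u) = d *: f u by rewrite -[d *: u]addr0 fL f0 addr0.
rewrite (letter_act_homog _ _ (sbracket_homog _ _ _ _ hy hz)).
rewrite !(letter_act_homog _ _ hy) !(letter_act_homog _ _ hz).
rewrite !(letter_act_homog _ _ hy).
rewrite (sbracket_jacobi_r _ hy hz) (env_inj_bracket hy hz).
rewrite !twist_bracket (twist_homog _ hy) (twist_homog _ hz) !twistK.
rewrite !sbracketZr fD -[- (_ *: sbracket _ _)]scaleNr !fZ (addbC b a).
have -> : (a (+) b) && c = (a && c) (+) (b && c) by case: a b c {hy hz} => [] [] [].
rewrite signr_addb (andbC b a) !scaleNr.
rewrite !mulrDr -!scalerAr !scalerDr !scalerA mulrBl -scalerAl scalerBr scalerA.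
rewrite -(mulrA (env_inj y)) -(mulrA (env_inj z)) !opprD.
set s1 := (-1) ^+ (a && b); set s2 := (-1) ^+ (a && c); set s3 := (-1) ^+ (b && c).
have s11 : s1 * s1 = 1 by rewrite -signr_addb addbb.
rewrite (mulrC s3 s1) (mulrAC s1 s2 s1) s11 mul1r.
rewrite (mulrC (s1 * s3)) (mulrA s2) (mulrAC s2 s1).
by rewrite (AC ((2*2)*(2*2)) (((1*5)*(4*8))*((2*7)*(3*6)))) /= !subrr !addr0.
Qed.

Definition free_act f w : F -> U := free_ext U (fun s => word_act s f w).

HB.instance Definition _ f w :=
  GRing.Linear.copy (free_act f w) (free_ext U (fun s => word_act s f w)).

Lemma free_act_word f w s : free_act f w (free_word s) = word_act s f w.
Proof. exact: free_ext_word. Qed.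

Lemma free_actP f w (d : K) (x y : F) :
  free_act f w (d *: x + y) = d *: free_act f w x + free_act f w y.
Proof. exact: linearP. Qed.

Lemma free_act0 f w : free_act f w 0 = 0.
Proof. exact: linear0. Qed.

Lemma eq_word_act s f h : f =1 h -> word_act s f =1 word_act s h.
Proof.
move=> e; elim: s => //= y s IH w; rewrite /letter_act IH; congr (_ + _).
by apply: eq_bigr => a _; rewrite IH.
Qed.

Lemma word_act_comb (d : K) s f h w :
  word_act s (fun x => d *: f x + h x) w =
    d *: word_act s f w + word_act s h w.
Proof.
elim: s w => //= y s IH w.
rewrite -letter_act_comb; exact: (eq_word_act [:: y]).
Qed.

Lemma word_act0 s w : word_act s (fun=> 0) w = 0.
Proof.
elim: s w => //= y s IH w; rewrite /letter_act IH add0r big1 // => a _.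
by rewrite IH mulr0 scaler0.
Qed.

Lemma word_act_linear s f : linear f -> linear (word_act s f).
Proof. by move=> fL; elim: s => //= y s; apply: letter_act_linear. Qed.

Lemma free_act_linear f x : linear f -> linear (free_act f ^~ x).
Proof.
move=> fL d u v; elim/free_ind: x => [|e x y hx hy|s].
- by rewrite !free_act0 scaler0 addr0.
- rewrite !free_actP hx hy !scalerDr addrACA !scalerA.
  by rewrite (mulrC e).
- by rewrite !free_act_word word_act_linear.
Qed.

Lemma eq_free_act f h w x : f =1 h -> free_act f w x = free_act h w x.
Proof.
move=> e; elim/free_ind: x => [|d x y hx hy|s]; first by rewrite !free_act0.
  by rewrite !free_actP hx hy.
by rewrite !free_act_word (eq_word_act _ e).
Qed.

Lemma free_actM f w (x y : F) :
  free_act f w (x * y) = free_act (free_act f ^~ y) w x.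
Proof.
elim/free_ind: x => [|d x x' hx hx'|s]; first by rewrite mul0r !free_act0.
  by rewrite mulrDl -scalerAl !free_actP hx hx'.
rewrite free_act_word; elim/free_ind: y => [|d y y' hy hy'|t].
- rewrite mulr0 free_act0 (eq_word_act _ (h := fun=> 0)) ?word_act0 // => w'.
  exact: free_act0.
- rewrite mulrDr -scalerAr free_actP hy hy' -word_act_comb.
  by apply: eq_word_act => w'; rewrite free_actP.
- rewrite -free_word_cat free_act_word /word_act foldr_cat.
  by apply: eq_word_act => w'; rewrite free_act_word.
Qed.

Lemma free_act_ideal f w x : linear f ->
  generated_ideal (env_relation (g := g)) x -> free_act f w x = 0.
Proof.
move=> fL hx; elim: hx f w fL => {x}
  [|x [d u v|a b u v hu hv]|x y _ hx _ hy|x y z _ hy] f w fL.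
- exact: free_act0.
- rewrite linearB linearD linearZ /= !free_act_word /=.
  by rewrite letter_act_letterD // subrr.
- rewrite !linearB linearZ /= -!free_word_cat !free_act_word /=.
  by rewrite letter_act_bracket // subrr.
- by rewrite linearD /= hx // hy // addr0.
(* The action of [z] keeps [f] linear, so the induction hypothesis for [y] applies to the result;
   [x] then acts on the zero function. *)
- rewrite !free_actM.
  rewrite (eq_free_act (h := fun=> 0)); last first.
    by move=> w'; apply: hy; apply: free_act_linear.
  elim/free_ind: x {hy} => [|d x y' hx hx'|s]; first by rewrite !free_act0.
    by rewrite !free_actP hx hx' scaler0 addr0.
  by rewrite free_act_word word_act0.
Qed.

(* [D u w] is [sum +- lambda (w . u') u''], summed over the coproduct of [u],
   where [g] acts on itself on the right by the adjoint action: the matrix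
   coefficients of the adjoint representation act on the enveloping algebra. *)
Lemma env_hit (lambda : g -> K) : scalar lambda ->
  exists D : U -> g -> U,
    [/\ forall w, linear (D^~ w),
        forall w, D 1 w = lambda w *: 1
      & forall a y u w, homog a y -> D (env_inj y * u) w =
          D u (sbracket w y)
          + (-1) ^+ (a && c) *: (env_inj y * D u (twist a w))].
Proof.
move=> lL; pose f0 w : U := lambda w *: 1.
have f0L : linear f0 by move=> d u v; rewrite /f0 lL scalerDl scalerA.
(* An arbitrary lift to the free algebra; [free_act_ideal] makes the action independent of it. *)
pose rep (u : U) : F := sval (cid (env_piP u)).
have repK u : env_pi (rep u) = u by rewrite -(svalP (cid (env_piP u))).
pose D u w := free_act f0 w (rep u).
have DE x w : D (env_pi x) w = free_act f0 w x.
  apply/eqP; rewrite -subr_eq0 -linearB; apply/eqP/free_act_ideal => //.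
  by apply/env_pi_eq; rewrite repK.
exists D; split=> [w d u v|w|a y u w hy].
- rewrite -[u]repK -[v]repK -linearP !DE; exact: free_actP.
- by rewrite -[in LHS](rmorph1 (@env_pi K g)) DE -free_word_nil free_act_word.
- rewrite -[u]repK -rmorphM /= !DE free_actM free_act_word /=.
  by rewrite (letter_act_homog _ _ hy).
Qed.

End Hit.

(** * Word length filtration and Euler identity *)

Section Filtration.
Context (K : fieldType) (g : lieSuperType K).
Local Notation U := (env g).
Local Notation word := (seq (bool * g)).
Implicit Types (s : word) (u v : U) (w x y : g).

Definition homog_word s := forall t, t \in s -> homog t.1 t.2.

Definition env_word s : U := foldr (fun t u => env_inj t.2 * u) 1 s.

(* [fil n] is spanned by the products of fewer than [n] elements of [g], so that
   [fil 0 = 0] and [fil 1 = K]. *)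
Definition fil n u : Prop :=
  exists2 ts : seq (K * word),
    forall t, t \in ts -> homog_word t.2 /\ (size t.2 < n)%N &
    u = \sum_(t <- ts) t.1 *: env_word t.2.

Lemma homog_word_cons t s :
  homog_word (t :: s) <-> homog t.1 t.2 /\ homog_word s.
Proof.
split=> [h|[ht hs] t']; last by rewrite inE => /predU1P[->|/hs].
by split=> [|t' t's]; apply: h; rewrite inE ?eqxx // t's orbT.
Qed.

Lemma fil0 n : fil n 0.
Proof. by exists [::]; rewrite ?big_nil. Qed.

Lemma filD n u v : fil n u -> fil n v -> fil n (u + v).
Proof.
move=> [ts hts ->] [ts' hts' ->]; exists (ts ++ ts'); last by rewrite big_cat.
by move=> t; rewrite mem_cat => /orP[/hts|/hts'].
Qed.

Lemma filZ n c u : fil n u -> fil n (c *: u).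
Proof.
move=> [ts hts ->]; exists [seq (c * t.1, t.2) | t <- ts].
  by move=> t /mapP[t' /hts ? ->].
by rewrite big_map scaler_sumr; apply: eq_bigr => t _; rewrite scalerA.
Qed.

Lemma filB n u v : fil n u -> fil n v -> fil n (u - v).
Proof. by move=> hu hv; apply: filD => //; rewrite -scaleN1r; apply: filZ. Qed.

Lemma fil_sum (I : eqType) n (r : seq I) (F : I -> U) :
  (forall i, i \in r -> fil n (F i)) -> fil n (\sum_(i <- r) F i).
Proof.
move=> h; rewrite big_seq; elim/big_rec: _ => [|i u ir hu]; first exact: fil0.
by apply: filD => //; apply: h.
Qed.

Lemma fil_le m n u : (m <= n)%N -> fil m u -> fil n u.
Proof.
move=> mn [ts hts ->]; exists ts => // t /hts[ht st].
by split=> //; apply: leq_trans mn.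
Qed.

Lemma fil_word n s : homog_word s -> (size s < n)%N -> fil n (env_word s).
Proof.
move=> hs sn; exists [:: (1, s)]; last by rewrite big_seq1 scale1r.
by move=> t; rewrite inE => /eqP->.
Qed.

Lemma fil0_eq0 u : fil 0 u -> u = 0.
Proof. by move=> [[|t ts] h ->]; rewrite ?big_nil //; case: (h t (mem_head _ _)). Qed.

Lemma fil1P u : fil 1 u -> exists c : K, u = c%:A.
Proof.
move=> [ts h ->]; exists (\sum_(t <- ts) t.1); rewrite scaler_suml !big_seq.
by apply: eq_bigr => t /h[_]; case: t => c [].
Qed.

Lemma fil_mul n y u : fil n u -> fil n.+1 (env_inj y * u).
Proof.
have H a x : homog a x -> fil n u -> fil n.+1 (env_inj x * u).
  move=> hx [ts hts ->]; exists [seq (t.1, (a, x) :: t.2) | t <- ts].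
    by move=> t /mapP[t' /hts[ht st] ->]; split=> //; apply/homog_word_cons.
  rewrite big_map mulr_sumr; apply: eq_bigr => t _.
  by rewrite -scalerAr.
move=> hu; rewrite -(spart_sum y) env_injD mulrDl.
by apply: filD; apply: H hu; apply: spart_homog.
Qed.

(** The truncated predecessor is harmless at [n = 0] because [fil 0] is zero. *)
Lemma fil_mul_pred n y u : fil n.-1 u -> fil n (env_inj y * u).
Proof.
case: n => [/fil0_eq0->|n]; last exact: fil_mul.
by rewrite mulr0; apply: fil0.
Qed.

Lemma fil_exhaustive u : exists n, fil n u.
Proof.
elim/env_ind: u => [|c u v [n hu] [m hv]||y u [n hu]].
- by exists 0%N; apply: fil0.
- exists (maxn n m); apply: filD; [apply: filZ|].
    by apply: fil_le hu; rewrite leq_maxl.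
  by apply: fil_le hv; rewrite leq_maxr.
- by exists 1%N; apply: (@fil_word 1 [::]).
- by exists n.+1; apply: fil_mul.
Qed.

Lemma fil_ind n (P : U -> Prop) :
  P 0 -> (forall (c : K) u v, P u -> P v -> P (c *: u + v)) ->
  (forall s, homog_word s -> (size s < n)%N -> P (env_word s)) ->
  forall u, fil n u -> P u.
Proof.
move=> P0 PD PW u [ts hts ->]; rewrite big_seq.
by elim/big_rec: _ => // t v /hts[hs sn]; apply: PD; apply: PW.
Qed.

(** A superderivation replaces one letter at a time by a bracket, which is again a single letter. *)
Lemma fil_ad b y n u : homog b y -> fil n u -> fil n (env_ad b y u).
Proof.
move=> hy; elim/fil_ind => {u} [|c u v hu hv|s].
- by rewrite env_ad0; apply: fil0.
- by rewrite env_adD env_adZ; apply: filD => //; apply: filZ.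
move=> + sn; move: (fil_le sn (u := env_ad b y (env_word s))) => + hs.
apply; elim: s hs {sn} => [_|[a x] s IH /homog_word_cons[/= hx hs]].
  by rewrite env_ad1; apply: fil0.
rewrite (env_adM _ hy hx); apply: filD.
  exact/fil_mul/fil_word.
exact/filZ/fil_mul/IH.
Qed.

(* The derivative of a word in the direction [phi]; the sign with which a letter
   is brought to the front is put into [phi]. *)
Fixpoint word_der (phi : g -> K) s : U :=
  if s is (a, y) :: s' then
    phi y *: env_word s' + env_inj y * word_der (phi \o twist a) s'
  else 0.

Lemma eq_word_der (phi psi : g -> K) s :
  phi =1 psi -> word_der phi s = word_der psi s.
Proof.
elim: s phi psi => //= -[a y] s IH phi psi e; rewrite e; congr (_ + _ * _).
by apply: IH => x /=.
Qed.

Lemma word_der_comb (c : K) (phi psi : g -> K) s :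
  word_der (fun x => c * phi x + psi x) s =
    c *: word_der phi s + word_der psi s.
Proof.
elim: s phi psi => /= [|[a y] s IH] phi psi; first by rewrite scaler0 addr0.
rewrite (eq_word_der (psi := fun x => c * (phi \o twist a) x + (psi \o twist a) x)) //.
by rewrite IH mulrDr -scalerAr scalerDr scalerDl scalerA addrACA.
Qed.

Lemma word_derZ (c : K) (phi : g -> K) s :
  word_der (fun x => c * phi x) s = c *: word_der phi s.
Proof.
elim: s phi => /= [|[a y] s IH] phi; first by rewrite scaler0.
rewrite (eq_word_der (psi := fun x => c * (phi \o twist a) x)) //.
by rewrite IH -scalerAr scalerDr scalerA.
Qed.

Lemma fil_word_der (phi : g -> K) s :
  homog_word s -> fil (size s) (word_der phi s).
Proof.
elim: s phi => [phi _|[a y] s IH phi /homog_word_cons[/= hy hs]]; first exact: fil0.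
by apply: filD; [apply/filZ/fil_word|apply/fil_mul/IH].
Qed.

(** Moving [b i] back to the position that [phi i] has evaluated rebuilds the word, once per
    position; each commutator met on the way costs a letter. *)
Lemma word_der_euler (n : nat) (phi : 'I_n -> g -> K) (b : 'I_n -> g) s :
  (forall i, scalar (phi i)) -> homog_word s ->
  (forall t, t \in s -> \sum_i phi i t.2 *: b i = t.2) ->
  fil (size s)
    (\sum_i env_inj (b i) * word_der (phi i) s - (size s)%:R *: env_word s).
Proof.
elim: s phi b => [|[a y] s IH] phi b phiL.
  move=> _ _; rewrite scale0r subr0 big1 => [|i _]; first exact: fil0.
  by rewrite mulr0.
move=> /homog_word_cons[/= hy hs] Hb.
have -> : \sum_i env_inj (b i) *
      (phi i y *: env_word s + env_inj y * word_der (phi i \o twist a) s) =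
    env_inj y * env_word s +
    (env_inj y * \sum_i env_inj (twist a (b i)) * word_der (phi i \o twist a) s
     + \sum_i env_inj (sbracket (b i) y) * word_der (phi i \o twist a) s).
  have Hy : env_inj y = \sum_i phi i y *: env_inj (b i).
    rewrite -[y in LHS](Hb _ (mem_head _ _)) linear_sum.
    by apply: eq_bigr => i _; apply: linearZ.
  rewrite [X in X * env_word s]Hy mulr_suml mulr_sumr -!big_split; apply: eq_bigr => i _ /=.
  rewrite mulrDr -scalerAr -scalerAl; congr (_ + _).
  by rewrite mulrA (env_inj_swap _ hy) mulrDl mulrA.
set X := \sum_i env_inj (twist _ _) * _; set Y := \sum_i _.
have -> : env_inj y * env_word s + (env_inj y * X + Y)
      - (size s).+1%:R *: (env_inj y * env_word s) =
    env_inj y * (X - (size s)%:R *: env_word s) + Y.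
  rewrite -natr1 scalerDl scale1r mulrBr -scalerAr opprD.
  by rewrite (AC ((1*2)*2) (((2*4)*3)*(1*5))) /= subrr addr0.
apply: filD.
  apply/fil_mul/IH => // [i d u v|t ts].
    by rewrite /= twistD twistZ phiL.
  (* Twisting both the functionals and the vectors by [a] keeps them dual on homogeneous letters, as
     the two signs cancel. *)
  have ht := hs t ts; rewrite /= (twist_homog _ ht).
  under eq_bigr => i _ do rewrite scalar_funZ // -scalerA -twistZ.
  rewrite -scaler_sumr -linear_sum (Hb t) ?inE ?ts ?orbT //=.
  by rewrite (twist_homog _ ht) scalerA -signr_addb addbb scale1r.
rewrite /Y; elim/big_rec: _ => [|i u _ hu]; first exact: fil0.
by apply: filD => //; apply/fil_mul/fil_word_der.
Qed.

End Filtration.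

(** * Symbols of the operators and of commutators *)

Section HitSymbol.
Context (K : fieldType) (g : lieSuperType K) (c : bool).
Local Notation U := (env g).
Local Notation word := (seq (bool * g)).
Context (lambda : g -> K) (D : U -> g -> U).
Context (lambdaL : scalar lambda).
Context (lambda_twist : forall a w,
  lambda (twist a w) = (-1) ^+ (a && c) * lambda w).
Context (DL : forall w, linear (D^~ w)).
Context (D1 : forall w, D 1 w = lambda w *: 1).
Context (DM : forall a y u w, homog a y -> D (env_inj y * u) w =
  D u (sbracket w y) + (-1) ^+ (a && c) *: (env_inj y * D u (twist a w))).
Implicit Types (s : word) (u v : U) (w x y : g).

Let DD u v w : D (u + v) w = D u w + D v w.
Proof. by rewrite -[u]scale1r DL !scale1r. Qed.

Let D0 w : D 0 w = 0.
Proof. by apply: (addIr (D 0 w)); rewrite -DD !add0r. Qed.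

Let DZ (d : K) u w : D (d *: u) w = d *: D u w.
Proof. by rewrite -[d *: u]addr0 DL D0 addr0. Qed.

(** A letter acting on [w] is lost from the word; in the term where none acts, the signs cancel
    because [lambda] has parity [c]. *)
Lemma hit_symbol s w : homog_word s ->
  fil (size s) (D (env_word s) w - lambda w *: env_word s).
Proof.
elim: s w => [w _|[a y] s IH w /homog_word_cons[/= hy hs]].
  by rewrite /= D1 subrr; apply: fil0.
rewrite (DM _ _ hy).
have -> : D (env_word s) (sbracket w y)
      + (-1) ^+ (a && c) *: (env_inj y * D (env_word s) (twist a w))
      - lambda w *: (env_inj y * env_word s) =
    D (env_word s) (sbracket w y) - lambda (sbracket w y) *: env_word s
    + (lambda (sbracket w y) *: env_word s
    + (-1) ^+ (a && c) *: (env_inj y *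
        (D (env_word s) (twist a w) - lambda (twist a w) *: env_word s))).
  rewrite addrA subrK mulrBr scalerBr addrA -scalerAr scalerA lambda_twist.
  by rewrite mulrA -signr_addb addbb mul1r.
apply: filD; first by apply: (fil_le (leqnSn _)); apply: IH.
by apply: filD; [apply/filZ/fil_word|apply/filZ/fil_mul/IH].
Qed.

Lemma hit_symbol_fil n u w : fil n u -> fil n.-1 (D u w - lambda w *: u).
Proof.
elim/fil_ind => {u} [|d u v hu hv|s hs sn].
- by rewrite D0 scaler0 subrr; apply: fil0.
- rewrite DD DZ scalerDr opprD addrACA scalerA (mulrC _ d) -scalerA -scalerBr.
  by apply: filD => //; apply: filZ.
apply: fil_le (hit_symbol w hs).
by case: n sn.
Qed.

(** Vanishing of [lambda] on [w] and on its brackets with one letter; the quantifier over [a] makes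
    it stable under twists. *)
Definition killed s w := forall a,
  lambda (twist a w) = 0 /\
  forall t, t \in s -> lambda (sbracket (twist a w) t.2) = 0.

Lemma killed_twist s w b : killed s w -> killed s (twist b w).
Proof. by move=> h a; rewrite twistK; apply: h. Qed.

Lemma killed_cons t s w : killed (t :: s) w ->
  [/\ lambda w = 0, lambda (sbracket w t.2) = 0 & killed s w].
Proof.
move=> h; have [h0 h1] := h false; rewrite twistF in h0 h1.
split=> // [|a]; first by apply: h1; rewrite mem_head.
by have [? h2] := h a; split=> // t' t's; apply: h2; rewrite inE t's orbT.
Qed.

(** The terms where at most one letter acts on [w] have zero leading part, so two letters are
    lost. *)
Lemma hit_killed s w : homog_word s -> killed s w ->
  fil (size s).-1 (D (env_word s) w).
Proof.
elim: s w => [w _ /(_ false)|[a y] s IH w /homog_word_cons[/= hy hs]].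
  by rewrite twistF => -[l0 _] /=; rewrite D1 l0 scale0r; apply: fil0.
move=> /killed_cons[_ /= l1 ks].
rewrite (DM _ _ hy); apply: filD.
  by have := hit_symbol (sbracket w y) hs; rewrite l1 scale0r subr0.
by apply/filZ/fil_mul_pred/IH => //; apply: killed_twist.
Qed.

(* All letters of [s] are invisible to [lambda], so the only contributions to
   the symbol come from the commutators [[x, y]], [y] a letter of [s]. *)
Lemma hit_ad b x s w : homog b x -> homog_word s -> killed s w ->
  fil (size s).-1 (D (env_ad b x (env_word s)) w
    - word_der (fun y => lambda (sbracket w (sbracket x y))) s).
Proof.
move=> hx; elim: s w => [w _ _|[a y] s IH w /homog_word_cons[/= hy hs]].
  by rewrite /= env_ad1 D0 subrr; apply: fil0.
move=> /killed_cons[_ /= l1 ks].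
have hxy := sbracket_homog _ _ _ _ hx hy.
rewrite (env_adM _ hx hy) DD DZ (DM _ _ hxy) (DM _ _ hy).
set phi := fun y => _.
set psi := fun y => lambda (sbracket (twist a w) (sbracket x y)).
(* The sign of passing [y] in [word_der] splits into the signs of [y] against [x] and against
   [lambda]. *)
have E z : phi (twist a z) = (-1) ^+ (a && b) * (-1) ^+ (a && c) * psi z.
  rewrite -mulrA -lambda_twist twist_bracket twistK addbb twistF.
  rewrite twist_bracket (twist_homog _ hx) sbracketZl sbracketZr.
  by rewrite (scalar_funZ _ _ lambdaL) mulrA -signr_addb addbb mul1r.
rewrite /= (eq_word_der _ E) word_derZ (andbC b a).
have Hx := hit_symbol (sbracket w (sbracket x y)) hs.
have Hy := hit_symbol_fil (sbracket w y) (fil_ad hx (fil_word hs (ltnSn _))).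
have Ha := IH _ hs (killed_twist a ks).
have Hk := hit_killed hs (killed_twist (b (+) a) ks).
move: Hy; rewrite l1 scale0r subr0 /= => Hy.
(* Four contributions: [[x, y]] acts on [w], or stays in front; [y] acts on [w], or stays in front.
   The first yields the leading term of [word_der], the last is the induction step, the others are
   short. *)
rewrite (_ : _ - _ = (D (env_word s) (sbracket w (sbracket x y)) - phi y *: env_word s)
   + (-1) ^+ ((b (+) a) && c) *: (env_inj (sbracket x y) * D (env_word s) (twist (b (+) a) w))
   + (-1) ^+ (a && b) *: D (env_ad b x (env_word s)) (sbracket w y)
   + ((-1) ^+ (a && b) * (-1) ^+ (a && c)) *: (env_inj y *
      (D (env_ad b x (env_word s)) (twist a w) - word_der psi s))).
  apply: filD; last exact/filZ/fil_mul_pred.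
  apply: filD; last exact/filZ.
  by apply: filD => //; apply/filZ/fil_mul_pred.
rewrite scalerDr scalerA mulrBr scalerBr -scalerAr opprD.
by rewrite (AC ((2*2)*2) ((((1*5)*2)*3)*(4*6))).
Qed.

End HitSymbol.

(** * Centers *)

Section Center.
Context (K : fieldType) (l : lieSuperType K).

Lemma homog_bracket_neq0 (e v : l) : sbracket e v <> 0 ->
  exists a e', homog a e' /\ sbracket e' v <> 0.
Proof.
move=> ev; have [e0|e0] := eqVneq (sbracket (spart false e) v) 0.
  exists true, (spart true e); split; first exact: spart_homog.
  by move=> e1; apply: ev; rewrite -(spart_sum e) sbracketDl e0 e1 addr0.
by exists false, (spart false e); split; [apply: spart_homog|apply/eqP].
Qed.

Lemma semisimple_centerless (v : l) :
  semisimple l -> (forall e, sbracket e v = 0) -> v = 0.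
Proof.
move=> ssl; pose I : set l := [set v | forall e, sbracket e v = 0].
(* All brackets in [I] vanish, so one derivation step suffices for solvability. *)
suff /ssl H : graded_ideal I by move=> hv; apply: H => //; exists 1%N => x /=;
  elim=> // [y z _ -> _ ->|c y z _ hz]; rewrite ?addr0 // hz scaler0.
have ext u : (forall a e, homog a e -> sbracket e u = 0) -> I u.
  move=> h e; rewrite -(spart_sum e) sbracketDl.
  by rewrite !(h _ _ (spart_homog _ _)) addr0.
have Ip a u : I u -> I (spart a u).
  move=> hu; apply: ext => b e he.
  (* For homogeneous [e], its brackets with the two components of [u] have different parities, so
     both vanish. *)
  have := hu e; rewrite -{1}(spart_sum u) sbracketDr => h.
  have := congr1 (spart (b (+) a)) h; rewrite spart0 spartD.
  rewrite !(homog_spart _ (sbracket_homog _ _ _ _ he (spart_homog _ _))).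
  by case: a; case: b {he} => /=; rewrite ?addr0 ?add0r.
split=> [e|c u v' hu hv e|a u|u v' hv e|u v' hv e] /=.
- exact: sbracket0r.
- by rewrite sbracketDr sbracketZr hu hv scaler0 addr0.
- exact: Ip.
- by rewrite hv sbracket0r.
- rewrite -(spart_sum v') -(spart_sum u) sbracketDl !sbracketDr.
  have h a b : sbracket (spart a v') (spart b u) = 0.
    rewrite (sbracket_skew _ _ _ _ (spart_homog _ _) (spart_homog _ _)).
    by rewrite (Ip a _ hv) scaler0 oppr0.
  by rewrite !h !sbracket0r !addr0.
Qed.

End Center.

(** * Coefficients of tensors in a fixed degree *)

Section Coefficients.
Context (K : fieldType) (M : nmodType) (l : lieSuperType K).
Local Notation g := (monoid_tensor M l).
Implicit Types (y : g).

Definition tcoef (r : M) y : l := mcoeff r (y : {malg l[M]}).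

Lemma tcoefD r x y : tcoef r (x + y) = tcoef r x + tcoef r y.
Proof. exact: mcoeffD. Qed.

Lemma tcoef0 r : tcoef r 0 = 0.
Proof. exact: mcoeff0. Qed.

Lemma tcoefU r e s : tcoef r << e *g s >> = e *+ (s == r).
Proof. exact: mcoeffU. Qed.

Lemma tcoefZ r (c : K) y : tcoef r (c *: y) = c *: tcoef r y.
Proof.
elim/monoid_tensor_ind: y => [|x y hx hy|e s].
- by rewrite scaler0 tcoef0 scaler0.
- by rewrite scalerDr !tcoefD hx hy scalerDr.
- by rewrite monoid_tensorZ !tcoefU; case: eqP; rewrite ?mulr1n // !mulr0n scaler0.
Qed.

Lemma tcoef_part r a y : tcoef r (spart a y) = spart a (tcoef r y).
Proof.
elim/monoid_tensor_ind: y => [|x y hx hy|e s].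
- by rewrite !(spart0, tcoef0).
- by rewrite !(spartD, tcoefD) hx hy.
- by rewrite monoid_tensor_part !tcoefU; case: eqP; rewrite // spart0.
Qed.

Lemma tcoef_twist r a y : tcoef r (twist a y) = twist a (tcoef r y).
Proof. by rewrite /twist tcoefD tcoefZ !tcoef_part. Qed.

Lemma twist_tensorU a e (s : M) :
  twist a (<< e *g s >> : g) = << twist a e *g s >>.
Proof.
by rewrite /twist !monoid_tensor_part monoid_tensorZ monalgUD.
Qed.

Lemma homog_tensorU a e (s : M) : homog a e -> homog a (<< e *g s >> : g).
Proof. by move=> he; rewrite /homog monoid_tensor_part he. Qed.

(** Cancellation by [s] prevents any other degree of [y] from contributing to degree [s + r]. *)
Lemma tcoef_bracket e s r y : injective (+%R s) ->
  tcoef (s + r) (sbracket (<< e *g s >> : g) y) = sbracket e (tcoef r y).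
Proof.
move=> sI; elim/monoid_tensor_ind: y => [|x y hx hy|f t].
- by rewrite tcoef0 !sbracket0r tcoef0.
- by rewrite sbracketDr !tcoefD hx hy sbracketDr.
rewrite monoid_tensor_bracket !tcoefU (inj_eq sI).
by case: eqP; rewrite // !mulr0n sbracket0r.
Qed.

Lemma tcoef_neq0 y : y <> 0 -> exists r, tcoef r y <> 0.
Proof.
move=> y0; apply: contrapT => h; apply: y0; apply/malgP => r.
by rewrite mcoeff0; apply: contrapT => hr; apply: h; exists r.
Qed.

End Coefficients.

(** * Descent of central elements along the length filtration *)

Section CentralElements.
Context (K : fieldType) (M : nmodType) (l : lieSuperType K).
Local Notation g := (monoid_tensor M l).
Context (K0 : [pchar K] =i pred0).
Context (MI : forall s : M, injective (+%R s)).
Context (Minf : forall (R : seq M) r, exists s, s + r \notin R).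
Context (lss : semisimple l).

Lemma central_fil n (z : env g) :
  supercenter (enveloping_superalgebra g) z -> fil n.+2 z -> fil n.+1 z.
Proof.
move=> zc [ts hts zE].
(* The derivative is taken of the chosen presentation [ts], since [word_der] is defined on words and
   not on [U]. *)
pose ders (phi : g -> K) := \sum_(t <- ts) t.1 *: word_der phi t.2.
pose Phi : set (g -> K) := [set phi | scalar phi /\ fil n (ders phi)].
pose letters : seq g := [seq x.2 | x <- flatten [seq t.2 | t <- ts]].
have lettersP t x : t \in ts -> x \in t.2 -> x.2 \in letters.
  by move=> tts xt; apply/map_f/flattenP; exists t.2 => //; apply: map_f.
have PhiS y : y <> 0 -> exists2 phi, Phi phi & phi y <> 0.
  have br (v : l) : v <> 0 -> exists a e, homog a e /\ sbracket e v <> 0.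
    move=> v0; have [e] : exists e, sbracket e v <> 0.
      apply: contrapT => h; apply: v0; apply: (semisimple_centerless lss) => e.
      by apply: contrapT => he; apply: h; exists e.
    exact: homog_bracket_neq0.
  (* Triviality of the center is used twice: [e] enters the element [Y] supercommuting with [z], and
     [e'] the argument [w] of the operator. *)
  move=> /tcoef_neq0[r /br[b [e [he /br[b' [e' [he' v0]]]]]]].
  have [c vc] : exists c, spart c (sbracket e' (sbracket e (tcoef r y))) <> 0.
    apply: contrapT => h; apply: v0; rewrite -[LHS]spart_sum.
    have h0 c : spart c (sbracket e' (sbracket e (tcoef r y))) = 0.
      by apply: contrapT => hc; apply: h; exists c.
    by rewrite !h0 addr0.
  have [f fL fv] := exists_functional vc.
  (* The degree [q] avoids [0], the degree of [w], and all degrees in the letters; this gives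
     [killed]. *)
  have [s sR] := Minf (0 :: flatten [seq enum_fset (msupp x) | x <- letters]) r.
  set q := s + r in sR.
  have q0 : q != 0 by apply: contraNneq sR => ->; rewrite mem_head.
  have low x : x \in letters -> tcoef q x = 0.
    move=> xl; apply: mcoeff_outdom; apply: contra sR => qx.
    rewrite inE; apply/orP; right; apply/flattenP.
    by exists (enum_fset (msupp x)) => //; apply/mapP; exists x.
  (* Projecting to parity [c] gives [lambda] a definite parity, hence the sign rule [lt]. *)
  pose lambda (x : g) : K := f (spart c (tcoef q x)).
  have lL : scalar lambda.
    by move=> d u v; rewrite /lambda tcoefD tcoefZ spartD spartZ fL.
  have lt a x : lambda (twist a x) = (-1) ^+ (a && c) * lambda x.
    rewrite /lambda tcoef_twist -(scalar_funZ _ _ fL); congr f.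
    rewrite /twist spartD spartZ !spartK.
    by case: (c) => /=; rewrite ?addr0 ?add0r ?andbT ?andbF ?scaler0 ?scale1r ?addr0.
  have [D [DL D1 DM]] := env_hit c lL.
  pose w : g := << e' *g 0 >>; pose Y : g := << e *g s >>.
  have brw (e0 : l) (x : g) : tcoef q (sbracket (<< e0 *g 0 >> : g) x) = sbracket e0 (tcoef q x).
    by have := tcoef_bracket e0 q x (@MI 0); rewrite add0r.
  exists (fun x => lambda (sbracket w (sbracket Y x))); last first.
    by rewrite /lambda brw tcoef_bracket.
  split=> [d u v|]; first by rewrite sbracketDr sbracketZr sbracketDr sbracketZr lL.
  have hY : homog b Y by apply: homog_tensorU.
  have DD0 : D 0 w = 0.
    have := DL w (-1) 0 0; rewrite scaler0 addr0 scaleN1r => ->.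
    exact: addNr.
  (* As [Y] supercommutes with [z], this sum vanishes, and the derivative of [z] is minus the total
     error in [hit_ad]. *)
  have DE : \sum_(t <- ts) t.1 *: D (env_ad b Y (env_word t.2)) w = 0.
    transitivity (D (env_ad b Y z) w); last by rewrite (supercenter_ad zc hY).
    rewrite zE.
    elim: (ts) => [|t ts' IH]; rewrite ?big_nil ?big_cons.
      by rewrite env_ad0 DD0.
    by rewrite env_adD env_adZ DL IH.
  rewrite (_ : ders _ = - \sum_(t <- ts) t.1 *: (D (env_ad b Y (env_word t.2)) w
     - word_der (fun x => lambda (sbracket w (sbracket Y x))) t.2)); last first.
    under [in RHS]eq_bigr do rewrite scalerBr.
    by rewrite sumrB DE sub0r opprK.
  rewrite -scaleN1r; apply/filZ/fil_sum => t tts; apply: filZ.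
  have [ht st] := hts t tts.
  apply: (@fil_le _ _ (size t.2).-1); first by case: (size _) st.
  apply: (hit_ad lL lt DL D1 DM) => // a; split=> [|x xt].
    by rewrite /lambda tcoef_twist tcoefU eq_sym (negbTE q0) linear0 spart0 scalar_fun0.
  rewrite /lambda twist_tensorU brw low ?sbracket0r ?spart0 ?scalar_fun0 //.
  exact: lettersP tts xt.
have PhiD (d : K) phi psi : Phi phi -> Phi psi -> Phi (fun x => d * phi x + psi x).
  move=> [phiL hphi] [psiL hpsi]; split=> [e u v|].
    by rewrite phiL psiL !mulrDr addrACA mulrCA.
  rewrite (_ : ders _ = d *: ders phi + ders psi); first exact/filD/hpsi/filZ.
  rewrite scaler_sumr -big_split; apply: eq_bigr => t _ /=.
  by rewrite word_der_comb scalerDr !scalerA mulrC.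
have [m [phi [b [Phii Hb]]]] := separating_dual letters (fun phi H => proj1 H) PhiD PhiS.
have E1 : fil n.+1 (\sum_i env_inj (b i) * ders (phi i)).
  elim/big_rec: _ => [|i u _ hu]; first exact: fil0.
  by apply: filD => //; apply: fil_mul; case: (Phii i).
have E2 : fil n.+1 (\sum_(t <- ts) t.1 *: (
    \sum_i env_inj (b i) * word_der (phi i) t.2 - (size t.2)%:R *: env_word t.2)).
  apply: fil_sum => t tts; have [ht st] := hts t tts.
  apply/filZ/(fil_le (_ : size t.2 <= n.+1)%N); first by rewrite -ltnS.
  apply: word_der_euler => // [i|x xt]; first by case: (Phii i).
  by apply: Hb; apply: lettersP tts xt.
(* Replaces the length of each word in the Euler identity by the common factor [n.+1]; words of top
   length get coefficient zero. *)
have E3 : fil n.+1 (\sum_(t <- ts) (t.1 * (n.+1%:R - (size t.2)%:R)) *: env_word t.2).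
  apply: fil_sum => t tts; have [ht st] := hts t tts.
  have [->|sn] := eqVneq (size t.2) n.+1.
    by rewrite subrr mulr0 scale0r; apply: fil0.
  by apply/filZ/fil_word => //; rewrite ltn_neqAle sn -ltnS.
have nz : n.+1%:R *: z = \sum_i env_inj (b i) * ders (phi i)
   - \sum_(t <- ts) t.1 *: (
    \sum_i env_inj (b i) * word_der (phi i) t.2 - (size t.2)%:R *: env_word t.2)
   + \sum_(t <- ts) (t.1 * (n.+1%:R - (size t.2)%:R)) *: env_word t.2.
  have -> : \sum_i env_inj (b i) * ders (phi i) =
      \sum_(t <- ts) t.1 *: \sum_i env_inj (b i) * word_der (phi i) t.2.
    under eq_bigr do rewrite mulr_sumr; rewrite exchange_big; apply: eq_bigr => t _.
    by rewrite scaler_sumr; apply: eq_bigr => i _; rewrite scalerAr.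
  rewrite -sumrB -big_split {1}zE scaler_sumr; apply: eq_bigr => t _ /=.
  rewrite scalerBr opprB addrCA subrr addr0 mulrBr scalerBl !scalerA.
  by rewrite addrC subrK mulrC.
rewrite -[z](scalerK (_ : n.+1%:R != 0)); last by move/pcharf0P: K0 => ->.
by rewrite nz; apply/filZ/filD => //; apply: filB.
Qed.

Lemma tensor_supercenter :
  supercenter (enveloping_superalgebra g) = [set c%:A | c in [set: K]].
Proof.
apply/seteqP; split=> [z zc|_ [c _ <-] u].
  have [n] := fil_exhaustive z.
  (* Levels [0] and [1] consist of scalars, and a central element descends from every higher
     level. *)
  elim: n => [/fil0_eq0->|[_ /fil1P[c ->]|n IH]].
  - by exists 0 => //; rewrite scale0r.
  - by exists c.
  - by move/(central_fil zc).
have hc : homog false (c%:A : enveloping_superalgebra g).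
  by rewrite /homog spartZ homog1.
rewrite /supercomm big1 // => a _; rewrite big1 // => b _.
rewrite !(homog_spart _ hc); case: eqP => [->|_] /=.
  by rewrite scale1r -scalerAl -scalerAr mul1r mulr1 subrr.
by rewrite mul0r mulr0 scaler0 subr0.
Qed.

End CentralElements.

Lemma avoid_nat (R : seq nat) (r : nat) : exists s, (s + r)%R \notin R.
Proof.
exists (\max_(x <- R) x).+1; apply/negP => sR.
have := @leq_bigmax_seq _ R xpredT id _ sR isT.
by rewrite leqNgt ltnS leq_addr.
Qed.

Lemma avoid_int (R : seq int) (r : int) : exists s, s + r \notin R.
Proof.
(* With [s = m - r] the sum is [m], a natural number that is no absolute value of a member of
   [R]. *)
have [m] := avoid_nat [seq `|x|%N | x <- R] 0%N.
rewrite addr0 => mR; exists (m%:Z - r); apply: contra mR; rewrite subrK => mR.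
by apply/mapP; exists m%:Z.
Qed.

Theorem proposition3p7 (K : closedFieldType) (l : lieSuperType K) :
  [pchar K] =i pred0 ->
  semisimple l ->
  supercenter (enveloping_superalgebra (current_superalgebra l)) =
    [set c%:A | c in [set: K]] /\
  supercenter (enveloping_superalgebra (loop_superalgebra l)) =
    [set c%:A | c in [set: K]].
Proof.
move=> K0 lss; split; apply: tensor_supercenter => //.
- exact: addnI.
- exact: avoid_nat.
- exact: addrI.
- exact: avoid_int.
Qed.
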